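(* Let $(M,F)$ be a conic pseudo-Finsler surface with $F$ defined on the conic sub-bundle $\mathcal A$, let $\phi:\mathcal A\to\mathbb R$ be a smooth function positively homogeneous of degree $0$ in $y$ with $\sigma+\varepsilon-(\phi_{;2})^2\neq0$ on $\mathcal A$, where $\sigma=\phi_{;2;2}+\varepsilon\mathcal I\phi_{;2}+2(\phi_{;2})^2$; put $\rho=1/(\sigma+\varepsilon-(\phi_{;2})^2)$ and $\overline F=e^{\phi}F$. Then the geodesic spray coefficients $\overline G^i$ and $G^i$ of $\overline F$ and $F$ are related by $$\overline G^i=G^i+Q\,m^i+P\,\ell^i,$$ where $$P=\tfrac14\big[-\phi_{;2}\,A+2F^2(\partial_k\phi)\ell^k\big],\qquad Q=\tfrac14\big[\varepsilon A+2\varepsilon F(\partial_kF)m^k-2F(\partial_kF)_{;2}\,\ell^k\big],$$ $$A=\big\{2F\phi_{;2}\,\rho\,(F\partial_k\phi+\partial_kF)+2F\rho\,(F\partial_k\phi+\partial_kF)_{;2}\big\}\ell^k-2\varepsilon F\rho\,(F\partial_k\phi+\partial_kF)m^k .$$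
   Context: Let $M$ be a smooth 2-dimensional manifold, $(x^1,x^2)$ local coordinates and $(x^i,y^i)$ the induced coordinates on $TM$; all formulas are in such a coordinate system and repeated indices are summed over $\{1,2\}$. Write $\partial_i=\partial/\partial x^i$, $\dot\partial_i=\partial/\partial y^i$. A function is $h(r)$ if it is positively homogeneous of degree $r$ in $y$. A conic sub-bundle is a non-empty open subset $\mathcal A\subset TM\setminus 0$ projecting onto $M$ and closed under multiplication by positive scalars. A conic pseudo-Finsler metric on $M$ is a smooth $h(1)$ function $F:\mathcal A\to\mathbb R$ such that $g_{ij}=\tfrac12\dot\partial_i\dot\partial_jF^2$ is non-degenerate at each point of $\mathcal A$; $(g^{ij})$ is the inverse matrix. A conic pseudo-Finsler surface is equipped with its modified Berwald frame: $F$ is nowhere zero on $\mathcal A$, $\ell_i=\dot\partial_iF$, $\ell^i=y^i/F$, $\varepsilon\in\{1,-1\}$ (the signature) is the sign of $\det(g_{ij})$, $m_1=-\sqrt{\varepsilon\det(g_{ij})}\,\ell^2$, $m_2=\sqrt{\varepsilon\det(g_{ij})}\,\ell^1$, $m^i=g^{ij}m_j$; thus $g_{ij}=\ell_i\ell_j+\varepsilon m_im_j$, $\ell^im_i=0$, $m^im_i=\varepsilon$. The main scalar $\mathcal I$ is defined by $F\,C_{ijk}=\mathcal I\,m_im_jm_k$, where $C_{ijk}=\tfrac12\dot\partial_kg_{ij}$. The geodesic spray coefficients of $F$ are $G^i=\tfrac14g^{ij}(y^k\dot\partial_j\partial_kF^2-\partial_jF^2)$; $\overline G^i$ is defined in the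 same way from $\overline F$ (the condition $\sigma+\varepsilon-(\phi_{;2})^2\ne0$ guarantees that $\overline F$ is a conic pseudo-Finsler metric). For a smooth function $f$ on $\mathcal A$, $f_{;2}:=\varepsilon F(\dot\partial_if)m^i$ and $f_{;2;2}:=(f_{;2})_{;2}$; for each fixed $k$, $(\partial_kF)_{;2}$ and $(F\partial_k\phi+\partial_kF)_{;2}$ denote this operation applied to the function in parentheses. *)

(* Defs.v *)
From HB Require Import structures.
From mathcomp Require Import all_boot all_order all_algebra.
From mathcomp Require Import all_classical all_reals all_analysis.

Set Implicit Arguments.
Unset Strict Implicit.
Unset Printing Implicit Defensive.

Import Order.TTheory GRing.Theory Num.Theory.
Import numFieldNormedType.Exports.

Local Open Scope classical_set_scope.
Local Open Scope ring_scope.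

(* f is C^oo on D, which is meant to be an open subset of a finite-dimensional
   space V: all iterated directional derivatives exist and are continuous. *)
Definition iter_derive (R : realType) (V W : normedModType R)
    (s : seq V) (f : V -> W) : V -> W :=
  foldr (fun v h => fun z => 'D_v h z) f s.

Definition smooth_on (R : realType) (V W : normedModType R)
    (D : set V) (f : V -> W) : Prop :=
  forall (s : seq V) (z : V), D z ->
    {for z, continuous (iter_derive s f)} /\
    forall v : V, derivable (iter_derive s f) z v.

(* The atlas need not be maximal; [param a] is the inverse of the coordinate
   map [coord a] and is only meaningful on [coord a @` dom a]. *)
Record surface (R : realType) := Surface {
  space :> topologicalType;
  chart : Type;
  dom : chart -> set space;
  coord : chart -> space -> 'rV[R]_2;
  param : chart -> 'rV[R]_2 -> space;
  space_hausdorff : hausdorff_space space;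
  space_second_countable : @second_countable space;
  dom_cover : forall p, exists a, dom a p;
  dom_open : forall a, open (dom a);
  codom_open : forall a, open (coord a @` dom a);
  coordK : forall a p, dom a p -> param a (coord a p) = p;
  coord_continuous : forall a p, dom a p -> {for p, continuous (coord a)};
  param_continuous : forall a x, (coord a @` dom a) x ->
    {for x, continuous (param a)};
  transition_smooth : forall a b,
    smooth_on (coord a @` (dom a `&` dom b)) (coord b \o param a) }.

Arguments dom {R M} a : rename.
Arguments coord {R M} a p : rename.
Arguments param {R M} a x : rename.

(* A tangent vector is a point together with a family of components, one for
   each chart around the point, that obeys the contravariant transformation
   rule  v^j = (d x'^j / d x^i) v^i.  Components in the other charts are set
   to 0, so that equality of tangent vectors is the expected one. *)
Record tangent (R : realType) (M : surface R) := Tangent {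
  base : M;
  comp : chart M -> 'rV[R]_2;
  comp_transition : forall a b, dom a base -> dom b base ->
    comp b = 'D_(comp a) (coord b \o param a) (coord a base);
  comp_outside : forall a, ~ dom a base -> comp a = 0 }.

Lemma deriveZdir (R : realType) (V W : normedModType R) (f : V -> W)
    (z v : V) (c : R) :
  derivable f z v -> 'D_(c *: v) f z = c *: 'D_v f z.
Proof.
move=> fv; have [->|c0] := eqVneq c 0; first by rewrite !scale0r derive0.
rewrite /derive; apply: cvg_lim => //.
have -> : (fun h : R => h^-1 *: ((f \o shift z) (h *: (c *: v)) - f z)) =
    (fun h : R => c *: (h^-1 *: ((f \o shift z) (h *: v) - f z))) \o
      (fun h => h * c).
  apply/funext => h /=; rewrite !scalerA invfM mulrCA mulrA.
  have [->|h0] := eqVneq h 0; first by rewrite !mul0r !scale0r /= !add0r subrr !scaler0.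
  by rewrite -mulrA mulfV ?mulr1.
apply: (@cvg_comp _ _ _ _ _ _ (0 : R)^').
- move=> A /= [e /= e0 Ae]; exists (e / `|c|) => /=.
    by rewrite divr_gt0 ?normr_gt0.
  move=> h /=; rewrite sub0r normrN => he h0; apply: Ae => /=.
    by rewrite sub0r normrN normrM -ltr_pdivlMr ?normr_gt0.
  by rewrite mulf_neq0.
- exact: (cvgZl_tmp (k := c) fv).
Qed.

Section TangentBundle.
Context {R : realType} {M : surface R}.
Implicit Types (A : set (tangent M)) (f : tangent M -> R) (a : chart M).

Fact tscale_transition (c : R) (v : tangent M) a b :
  dom a (base v) -> dom b (base v) ->
  c *: comp v b =
    'D_(c *: comp v a) (coord b \o param a) (coord a (base v)).
Proof.
move=> va vb; rewrite deriveZdir -?comp_transition//.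
have Dv : (coord a @` (dom a `&` dom b)) (coord a (base v)) by exists (base v).
exact: (transition_smooth [::] Dv).2.
Qed.

Fact tscale_outside (c : R) (v : tangent M) a :
  ~ dom a (base v) -> c *: comp v a = 0.
Proof. by move=> va; rewrite comp_outside// scaler0. Qed.

Definition tscale (c : R) (v : tangent M) : tangent M :=
  Tangent (@tscale_transition c v) (@tscale_outside c v).

(* A subset A of TM and a function f on TM, read in the coordinates (x, y) of
   TM induced by the chart a.  As the tangent vector with given coordinates is
   unique, [loc_fun a f] is f in these coordinates; its value is 0 where there
   is no such vector, i.e. when x is not in the range of the chart. *)
Definition tcoord a (v : tangent M) : 'rV[R]_2 * 'rV[R]_2 :=
  (coord a (base v), comp v a).

Definition loc_set a A : set ('rV[R]_2 * 'rV[R]_2) :=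
  tcoord a @` [set v | A v /\ dom a (base v)].

Definition loc_fun a f (z : 'rV[R]_2 * 'rV[R]_2) : R :=
  xget 0 [set r | exists v, [/\ dom a (base v), tcoord a v = z & r = f v]].

(* Openness in TM and smoothness of functions on TM refer to the usual manifold
   structure of TM, whose charts are the induced coordinates. *)
Definition conic_subbundle A : Prop :=
  [/\ A !=set0,
      forall a, open (loc_set a A),
      forall v, A v -> exists a, comp v a != 0,
      forall p : M, exists v, A v /\ base v = p &
      forall v c, A v -> 0 < c -> A (tscale c v)].

Definition tsmooth A f : Prop :=
  forall a, smooth_on (loc_set a A) (loc_fun a f).

Definition homogeneous A (r : nat) f : Prop :=
  forall v c, A v -> 0 < c -> f (tscale c v) = c ^+ r * f v.

End TangentBundle.

(* Everything below is in one induced coordinate system (x, y).  Indices run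
   over 'I_2 = {0, 1}, so that y^1, y^2 are [z.2 0 0], [z.2 0 1]. *)
Section Coordinates.
Context {R : realType}.
Notation E := ('rV[R]_2 * 'rV[R]_2)%type.
Implicit Types (F phi f : E -> R) (i j k : 'I_2) (z : E).

Definition dx i f z : R := 'D_((delta_mx 0 i, 0) : E) f z.
Definition dy i f z : R := 'D_((0, delta_mx 0 i) : E) f z.

Definition gmx F z : 'M[R]_2 :=
  \matrix_(i, j) (2^-1 * dy i (dy j (fun w => F w ^+ 2)) z).
Definition ginv F z : 'M[R]_2 := invmx (gmx F z).

Definition spray F i z : R :=
  4^-1 * \sum_j ginv F z i j *
    (\sum_k z.2 0 k * dy j (dx k (fun w => F w ^+ 2)) z
     - dx j (fun w => F w ^+ 2) z).

Definition signature F z : R := Num.sg (\det (gmx F z)).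

(* Suffixes: _lo for a lower index, _up for an upper one. *)
Definition ell_up F i z : R := z.2 0 i / F z.

Definition m_lo F i z : R :=
  let s := Num.sqrt (signature F z * \det (gmx F z)) in
  if i == 0 then - s * ell_up F 1 z else s * ell_up F 0 z.
Definition m_up F i z : R := \sum_j ginv F z i j * m_lo F j z.

Definition cartan F i j k z : R :=
  2^-1 * dy k (fun w => gmx F w i j) z.

Definition main_scalar F z : R :=
  xget 0 [set I : R | forall i j k,
    F z * cartan F i j k z = I * m_lo F i z * m_lo F j z * m_lo F k z].

(* f_{;2} *)
Definition sc2 F f z : R :=
  signature F z * F z * \sum_i dy i f z * m_up F i z.

Definition sigma F phi z : R :=
  sc2 F (sc2 F phi) z + signature F z * main_scalar F z * sc2 F phi z
  + 2 * sc2 F phi z ^+ 2.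

Definition rho_den F phi z : R :=
  sigma F phi z + signature F z - sc2 F phi z ^+ 2.
Definition rho F phi z : R := (rho_den F phi z)^-1.

(* F d_k phi + d_k F *)
Definition dFphi F phi k z : R := F z * dx k phi z + dx k F z.

Definition Acoef F phi z : R :=
  \sum_k (2 * F z * sc2 F phi z * rho F phi z * dFphi F phi k z
          + 2 * F z * rho F phi z * sc2 F (dFphi F phi k) z) * ell_up F k z
  - 2 * signature F z * F z * rho F phi z *
      \sum_k dFphi F phi k z * m_up F k z.

Definition Pcoef F phi z : R :=
  4^-1 * (- sc2 F phi z * Acoef F phi z
          + 2 * F z ^+ 2 * \sum_k dx k phi z * ell_up F k z).

Definition Qcoef F phi z : R :=
  4^-1 * (signature F z * Acoef F phi z
          + 2 * signature F z * F z * \sum_k dx k F z * m_up F k z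
          - 2 * F z * \sum_k sc2 F (dx k F) z * ell_up F k z).

End Coordinates.

Definition conic_pseudo_Finsler (R : realType) (M : surface R)
    (A : set (tangent M)) (F : tangent M -> R) : Prop :=
  [/\ conic_subbundle A, tsmooth A F, homogeneous A 1 F &
      forall a z, loc_set a A z -> gmx (loc_fun a F) z \in unitmx].

(* Main.v *)
(** Write [d_i] for the derivative along [y^i]; everything is decomposed in the frame
[(l_i, m_i)].  Euler's identities give
[F d_i d_j F = e m_i m_j] and [F d_i phi = phi_2 m_i] (with [phi_2] for
[phi_{;2}]); differentiating the latter, and using
[F m^i m^k d_k m_i = e I] (obtained by differentiating [g = l l + e m m]), yields
[F^2 d_i d_j phi = (phi_22 + e I phi_2) m_i m_j - phi_2 (l_i m_j + m_i l_j)].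
Hence the metric of [G = e^phi F] is
[e^(2 phi) (l l + phi_2 (l m + m l) + (sigma + e) m m)], a 2 x 2 matrix in the frame
whose determinant is [1 / rho] up to the exponential, and the Euler-Lagrange
covector of [G^2] is expanded in the same way.  Solving the resulting linear
system expresses the spray of [G] in the dual frame; the case [phi = 0] expresses
that of [F], and the theorem is the difference. *)
Require Import Defs.
From mathcomp Require Import all_boot all_order all_algebra.
From mathcomp Require Import all_classical all_reals all_analysis.
From mathcomp Require Import ring.

Set Implicit Arguments.
Unset Strict Implicit.
Unset Printing Implicit Defensive.

Import Order.TTheory GRing.Theory Num.Theory.
Import numFieldNormedType.Exports.

Local Open Scope classical_set_scope.
Local Open Scope ring_scope.

(** * Directional derivatives *)

(** The two difference quotients coincide term by term. Restriction to a line gives access to the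
    mean value theorem and the chain rule in one variable. *)
Lemma is_derive_line (R : realType) (V W : normedModType R) (f : V -> W)
    (p u : V) (t : R) :
  derivable f (p + t *: u) u ->
  is_derive t 1 (fun s : R => f (p + s *: u)) ('D_u f (p + t *: u)).
Proof.
have E : (fun h : R => h^-1 *: (((fun s : R => f (p + s *: u)) \o shift t)
            (h *: (1 : R)) - f (p + t *: u))) =
         (fun h : R => h^-1 *: ((f \o shift (p + t *: u)) (h *: u)
            - f (p + t *: u))).
  by apply/funext => h /=; rewrite -[h *: 1]/(h * 1) mulr1 scalerDl addrCA.
move=> fu; split; first by rewrite /derivable E.
by rewrite /derive E.
Qed.

Lemma mean_value_line (R : realType) (V : normedModType R) (f : V -> R)
    (p u : V) (h : R) : 0 < h ->
  (forall t, 0 <= t <= h -> derivable f (p + t *: u) u) ->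
  exists2 t, 0 <= t <= h & f (p + h *: u) - f p = h * 'D_u f (p + t *: u).
Proof.
move=> h0 fu.
have D (t : R) : t \in `[0, h] ->
    is_derive t 1 (fun s : R => f (p + s *: u)) ('D_u f (p + t *: u)).
  by rewrite in_itv /= => th; apply: is_derive_line; exact: fu.
have D' t : t \in `]0, h[ ->
    is_derive t 1 (fun s : R => f (p + s *: u)) ('D_u f (p + t *: u)).
  by move=> tI; apply: D; exact: subset_itv_oo_cc tI.
have C : {within `[0, h], continuous (fun s : R => f (p + s *: u))}.
  by apply: derivable_within_continuous => t tI; have [] := D t tI.
have [t tI E] := MVT_segment (ltW h0) D' C.
exists t; first by rewrite in_itv /= in tI.
by move: E; rewrite scale0r addr0 subr0 mulrC.
Qed.

(** The mean value theorem yields unknown intermediate points; a whole parallelogram inside [N]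
    makes the estimates valid at each of them. *)
Lemma nbhs_parallelogram (R : realType) (V : normedModType R) (z u v : V)
    (N : set V) : nbhs z N ->
  exists2 d : R, 0 < d &
    forall s t, 0 <= s <= d -> 0 <= t <= d -> N (z + s *: u + t *: v).
Proof.
move=> /nbhs_ballP[e /= e0 eN].
(* The displacement has norm at most [d] times the sum of the two norms; the extra [1] makes this
   strictly less than [e], even when both vectors vanish. *)
exists (e / (`|u| + `|v| + 1)).
  by rewrite divr_gt0// ltr_wpDl// addr_ge0.
set d := _ / _ => s t /andP[s0 sd] /andP[t0 td]; apply: eN.
have d0 : 0 < d by rewrite divr_gt0// ltr_wpDl// addr_ge0.
rewrite -ball_normE /= -addrA opprD addNKr normrN.
apply: (le_lt_trans (ler_normD _ _)); rewrite !normrZ !ger0_norm//.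
apply: (@le_lt_trans _ _ (d * (`|u| + `|v|))).
  by rewrite mulrDr lerD// ler_wpM2r.
have -> : e = d * (`|u| + `|v| + 1).
  by rewrite /d divfK// gt_eqF// ltr_wpDl// addr_ge0.
by rewrite ltr_pM2l// ltrDl.
Qed.

(* Both mixed derivatives are limits of the second difference quotient
   [(f (z + h u + h v) - f (z + h u) - f (z + h v) + f z) / h^2]. *)
Lemma derive_swap (R : realType) (V : normedModType R) (f : V -> R)
    (U : set V) (z u v : V) : nbhs z U ->
  (forall w, U w -> derivable f w u /\ derivable f w v) ->
  (forall w, U w -> derivable ('D_u f) w v /\ derivable ('D_v f) w u) ->
  {for z, continuous ('D_v ('D_u f))} -> {for z, continuous ('D_u ('D_v f))} ->
  'D_v ('D_u f) z = 'D_u ('D_v f) z.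
Proof.
move=> zU f1 f2 cvu cuv; apply/eqP; rewrite -subr_eq0 -normr_le0.
apply/ler_addgt0Pl => e e0; rewrite addr0.
have e20 : 0 < e / 2 by rewrite divr_gt0.
have /cvgrPdist_lt/(_ _ e20) Nvu := cvu.
have /cvgrPdist_lt/(_ _ e20) Nuv := cuv.
have [d d0 dN] := nbhs_parallelogram u v (filterI zU (filterI Nvu Nuv)).
have dd : 0 <= d <= d by rewrite ltW//=.
have z0d : 0 <= (0 : R) <= d by rewrite lexx ltW.
(* The mean value theorem is applied along [a] to the increment of [f] by [d *: b], then along [b]
   to ['D_a f]. Exchanging [a] and [b] does not change the second difference. *)
have key (a b : V) :
  (forall w, U w -> derivable f w a) -> (forall w, U w -> derivable ('D_a f) w b) ->
  (forall s t, 0 <= s <= d -> 0 <= t <= d -> U (z + s *: a + t *: b)) ->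
  exists s t, [/\ 0 <= s <= d, 0 <= t <= d &
   f (z + d *: a + d *: b) - f (z + d *: b) - (f (z + d *: a) - f z) =
   d * (d * 'D_b ('D_a f) (z + s *: a + t *: b))].
  move=> fa fab abU.
  have aux (s t : R) : 0 <= s <= d -> 0 <= t <= d ->
     derivable f (z + t *: b + s *: a) a.
    by move=> sd td; apply: fa; rewrite addrAC; exact: abU.
  have H t : 0 <= t <= d -> derivable (fun w => f (w + d *: b) - f w) (z + t *: a) a.
    move=> td; apply: derivableB; last first.
      by have := aux t 0 td z0d; rewrite scale0r addr0.
    have := aux t d td dd; rewrite addrAC /derivable.
    by under eq_fun do rewrite /= addrA.
  have [s sd] := mean_value_line d0 H.
  have -> : 'D_a (fun w => f (w + d *: b) - f w) (z + s *: a) =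
     'D_a f (z + s *: a + d *: b) - 'D_a f (z + s *: a).
    rewrite deriveB; last 2 first.
    - have := aux s d sd dd; rewrite addrAC /derivable.
      by under eq_fun do rewrite /= addrA.
    - by have := aux s 0 sd z0d; rewrite scale0r addr0.
    by congr (_ - _); rewrite /derive; under eq_fun do rewrite /= -addrA.
  have [|t td ->] := @mean_value_line _ _ ('D_a f) (z + s *: a) b d d0.
    by move=> t td; apply: fab; exact: abU.
  by move=> E; exists s, t; split => //; rewrite -E; ring.
have [|||s [t [sd td E1]]] := key u v.
- by move=> w /f1[].
- by move=> w /f2[].
- by move=> s t sd td; have [] := dN s t sd td.
have [|||s' [t' [sd' td' E2]]] := key v u.
- by move=> w /f1[].
- by move=> w /f2[].
- by move=> s' t' sd' td'; rewrite addrAC; have [] := dN t' s' td' sd'.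
have [_ [A1 _]] := dN s t sd td; have [_ [_ A2]] := dN t' s' td' sd'.
rewrite /= [z + t' *: u + s' *: v]addrAC in A1 A2.
rewrite [z + d *: v + d *: u]addrAC in E2.
move: A1 A2 E1 E2; set X := 'D_v ('D_u f) z; set Y := 'D_u ('D_v f) z.
set X' := 'D_v ('D_u f) _; set Y' := 'D_u ('D_v f) _.
move: (f (z + d *: u + d *: v)) (f (z + d *: v)) (f (z + d *: u)) (f z).
(* Both are the same second difference divided by [d ^+ 2], and each is within [e / 2] of its value
   at [z]. *)
move=> a b c k A1 A2 E1 E2; have E : X' = Y'.
  apply/(mulfI (lt0r_neq0 d0))/(mulfI (lt0r_neq0 d0)).
  by apply: etrans (esym E1) (etrans _ E2); rewrite !opprB addrACA [- b + _]addrC addrACA.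
rewrite -E in A2; rewrite -(subrKA X') [leRHS]splitr.
apply: (le_trans (ler_normD _ _)); apply: lerD; first exact: (ltW A1).
by rewrite distrC; exact: (ltW A2).
Qed.

(** Derivability is only directional, so additivity in the direction needs an argument: the
    displacement [h *: (u + v)] is made along [u], then along [v], with the mean value theorem on
    each leg; continuity at [z] controls the intermediate points. *)
Lemma deriveDdir (R : realType) (V : normedModType R) (f : V -> R)
    (U : set V) (z u v : V) : nbhs z U ->
  (forall w, U w -> derivable f w u /\ derivable f w v) ->
  derivable f z (u + v) ->
  {for z, continuous ('D_u f)} -> {for z, continuous ('D_v f)} ->
  'D_(u + v) f z = 'D_u f z + 'D_v f z.
Proof.
move=> zU f1 fuv cu cv; apply/eqP; rewrite -subr_eq0 -normr_le0.
apply/ler_addgt0Pl => e e0; rewrite addr0.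
have e30 : 0 < e / 3 by rewrite divr_gt0.
have /cvgrPdist_lt/(_ _ e30) Nu := cu.
have /cvgrPdist_lt/(_ _ e30) Nv := cv.
have [d d0 dN] := nbhs_parallelogram u v (filterI zU (filterI Nu Nv)).
have /cvgrPdist_lt/(_ _ e30)[r /= r0 rq] := fuv.
(* Below [d], both legs stay in the good neighbourhood; below [r], the difference quotient is within
   [e / 3] of the derivative along [u + v]. *)
pose h := Num.min d (r / 2).
have h0 : 0 < h by rewrite lt_min d0 divr_gt0.
have hd : h <= d by rewrite ge_min lexx.
have hh : 0 <= h <= d by rewrite ltW.
have z0d : 0 <= (0 : R) <= d by rewrite lexx ltW.
have hr : h < r.
  by rewrite gt_min; apply/orP; right; rewrite ltr_pdivrMr// ltr_pMr// ltr1n.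
have /= := rq h; rewrite sub0r normrN gtr0_norm// => /(_ hr (lt0r_neq0 h0)) Q.
have hI t : 0 <= t <= h -> 0 <= t <= d.
  by move=> /andP[-> th]; exact: le_trans th hd.
have fu t : 0 <= t <= h -> derivable f (z + t *: u) u.
  move=> /hI td; have [+ _] := dN t 0 td z0d.
  by rewrite scale0r addr0 => /f1[].
have fv t : 0 <= t <= h -> derivable f (z + h *: u + t *: v) v.
  by move=> /hI td; have [/f1[]] := dN h t hh td.
have [s sh E1] := mean_value_line h0 fu.
have [t th E2] := mean_value_line h0 fv.
have [_ [+ _]] := dN s 0 (hI _ sh) z0d; rewrite scale0r addr0 /= => A1.
have [_ [_ A2]] := dN h t hh (hI _ th); rewrite /= in A2.
have E : h^-1 *: (f (h *: (u + v) + z) - f z) =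
    'D_u f (z + s *: u) + 'D_v f (z + h *: u + t *: v).
  rewrite -[LHS]/(h^-1 * _) [_ + z]addrC scalerDr addrA.
  apply: (mulfI (lt0r_neq0 h0)); rewrite mulVKf ?lt0r_neq0// mulrDr -E1 -E2.
  by rewrite [RHS]addrC subrKA.
rewrite E -/('D_(u + v) f z) in Q; move: A1 A2 Q.
set X := 'D_(u + v) f z; set Y := 'D_u f z; set Z := 'D_v f z.
set Y' := 'D_u f _; set Z' := 'D_v f _ => A1 A2 Q.
have -> : X - (Y + Z) = (X - (Y' + Z')) + ((Y' - Y) + (Z' - Z)) by ring.
have -> : e = e / 3 + (e / 3 + e / 3) by field.
apply: (le_trans (ler_normD _ _)); apply: lerD; first exact: (ltW Q).
apply: (le_trans (ler_normD _ _)); apply: lerD; rewrite distrC.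
  exact: (ltW A1).
exact: (ltW A2).
Qed.

(** On the line through [z] in direction [v] this is the chain rule in one variable. *)
Lemma is_derive_comp1 (R : realType) (V : normedModType R) (f : V -> R)
    (g : R -> R) (z v : V) (df dg : R) :
  is_derive z v f df -> is_derive (f z) 1 g dg ->
  is_derive z v (g \o f) (dg * df).
Proof.
move=> [fv <-] Dg.
have E (k : V -> R) : (fun h : R => h^-1 *: ((k \o shift z) (h *: v) - k z)) =
    (fun h : R => h^-1 *: (((fun s : R => k (z + s *: v)) \o shift 0)
        (h *: (1 : R)) - k (z + 0 *: v))).
  apply/funext => h /=; rewrite scale0r !addr0 -[h *: 1]/(h * 1) mulr1.
  by rewrite [z + _]addrC.
have Df : is_derive (0 : R) 1 (fun s : R => f (z + s *: v)) ('D_v f z).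
  have := @is_derive_line _ _ _ f z v 0; rewrite scale0r addr0; exact.
have Dg' : is_derive (f (z + 0 *: v)) 1 g dg by rewrite scale0r addr0.
have [D1 D2] : is_derive (0 : R) 1 (g \o (fun s : R => f (z + s *: v)))
   (dg *: 'D_v f z) by apply: is_derive1_comp.
by split; [rewrite /derivable E | rewrite /derive E].
Qed.

(** * Dual frames of the plane *)

Lemma sum_I2 (V : nmodType) (h : 'I_2 -> V) : \sum_i h i = h 0 + h 1.
Proof.
rewrite big_ord_recl big_ord_recl big_ord0 addr0; congr (h _ + h _).
exact/val_inj.
Qed.

Section DualFrame.
Context {K : fieldType}.
Implicit Types (l m lu mu c : 'I_2 -> K) (e p q a b : K).

Lemma ord2P (i : 'I_2) : {i = 0} + {i = 1}.
Proof.
by case: i => [[|[|[]]] // ?]; [left|right]; exact/val_inj.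
Qed.

Lemma det_mx2 (G : 'M[K]_2) : \det G = G 0 0 * G 1 1 - G 0 1 * G 1 0.
Proof.
rewrite (expand_det_row _ 0) sum_I2 /cofactor !det_mx11 !mxE /= !expr0 expr1.
have -> : lift (0 : 'I_2) (0 : 'I_1) = 1 by exact/val_inj.
have -> : lift (1 : 'I_2) (0 : 'I_1) = 0 by exact/val_inj.
by ring.
Qed.

(** [e] is the signature, [l] and [m] are covectors, [lu] and [mu] vectors. Since [mu] is [m] with
    its index raised, the last pairing is [e], so the dual basis proper is [lu], [e mu]. *)
Definition dual_frame e l m lu mu := [/\ e * e = 1,
  \sum_i lu i * l i = 1, \sum_i lu i * m i = 0,
  \sum_i mu i * l i = 0 & \sum_i mu i * m i = e].

(** The determinants of the vectors and of the covectors multiply to that of the pairing matrix,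
    which is [e], a unit. *)
Lemma dual_frame_det e l m lu mu : dual_frame e l m lu mu ->
  l 0 * m 1 - l 1 * m 0 != 0.
Proof.
rewrite /dual_frame !sum_I2 => -[ee ll lm ml mm]; apply/eqP => w0.
have : (lu 0 * l 0 + lu 1 * l 1) * (mu 0 * m 0 + mu 1 * m 1) -
    (lu 0 * m 0 + lu 1 * m 1) * (mu 0 * l 0 + mu 1 * l 1) =
  (lu 0 * mu 1 - lu 1 * mu 0) * (l 0 * m 1 - l 1 * m 0) by ring.
rewrite w0 ll lm mm mul1r mul0r subr0 mulr0 => e0.
by move/eqP: ee; rewrite e0 mul0r eq_sym oner_eq0.
Qed.

(** The difference [d] of the two sides is annihilated by [lu] and [mu], which are linearly
    independent. *)
Lemma dual_frame_expand e l m lu mu c : dual_frame e l m lu mu -> forall j,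
  c j = (\sum_i c i * lu i) * l j + e * (\sum_i c i * mu i) * m j.
Proof.
move=> D; have w0 := dual_frame_det D.
move: D; rewrite /dual_frame !sum_I2 => -[ee ll lm ml mm].
set d := fun j => c j -
  ((c 0 * lu 0 + c 1 * lu 1) * l j + e * (c 0 * mu 0 + c 1 * mu 1) * m j).
have dl : d 0 * lu 0 + d 1 * lu 1 = 0.
  have -> : d 0 * lu 0 + d 1 * lu 1 =
   (c 0 * lu 0 + c 1 * lu 1) * (1 - (lu 0 * l 0 + lu 1 * l 1)) -
   e * (c 0 * mu 0 + c 1 * mu 1) * (lu 0 * m 0 + lu 1 * m 1).
    by rewrite /d; ring.
  by rewrite ll lm; ring.
have dm : d 0 * mu 0 + d 1 * mu 1 = 0.
  have -> : d 0 * mu 0 + d 1 * mu 1 = (c 0 * mu 0 + c 1 * mu 1) *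
      (1 - e * (mu 0 * m 0 + mu 1 * m 1)) -
    (c 0 * lu 0 + c 1 * lu 1) * (mu 0 * l 0 + mu 1 * l 1) by rewrite /d; ring.
  by rewrite mm ml ee; ring.
(* Vectors and covectors exchange roles: the definition of a dual frame is symmetric in them. *)
have u0 : lu 0 * mu 1 - lu 1 * mu 0 != 0.
  have := @dual_frame_det e lu mu l m; rewrite /dual_frame !sum_I2; apply.
  by split; rewrite // 1?mulrC [X in _ + X]mulrC.
have d0 : d 0 = 0.
  apply: (mulIf u0); rewrite mul0r.
  have -> : d 0 * (lu 0 * mu 1 - lu 1 * mu 0) =
    (d 0 * lu 0 + d 1 * lu 1) * mu 1 - (d 0 * mu 0 + d 1 * mu 1) * lu 1 by ring.
  by rewrite dl dm !mul0r subrr.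
have d1 : d 1 = 0.
  apply: (mulIf u0); rewrite mul0r.
  have -> : d 1 * (lu 0 * mu 1 - lu 1 * mu 0) =
    (d 0 * mu 0 + d 1 * mu 1) * lu 0 - (d 0 * lu 0 + d 1 * lu 1) * mu 0 by ring.
  by rewrite dl dm !mul0r subrr.
by move=> j; apply/eqP; rewrite -subr_eq0; case: (ord2P j) => ->;
  rewrite -/(d 0) -/(d 1) ?d0 ?d1.
Qed.

(** In the frame, [G] is [k] times the symmetric matrix with entries 1, p, q, whose inverse has
    entries q, -p, 1 over [q - p ^+ 2]. The solution [x] read off from it is verified by multiplying
    by [G]. *)
Lemma frame_solve e l m lu mu (G : 'M[K]_2) k p q a b :
  dual_frame e l m lu mu -> k != 0 -> q - p ^+ 2 != 0 ->
  (forall i j, G i j =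
     k * (l i * l j + p * (l i * m j + m i * l j) + q * m i * m j)) ->
  forall i, \sum_j invmx G i j * (k * (a * l j + b * m j)) =
    (q - p ^+ 2)^-1 * ((q * a - p * b) * lu i + (b - p * a) * (e * mu i)).
Proof.
move=> D k0 r0 GE; have w0 := dual_frame_det D.
have Gu : G \in unitmx.
  rewrite unitmxE unitfE det_mx2 !GE.
  set t := (X in X != 0).
  have -> : t = k ^+ 2 * (q - p ^+ 2) * (l 0 * m 1 - l 1 * m 0) ^+ 2.
    by rewrite /t; ring.
  by rewrite !mulf_neq0 ?expf_neq0.
pose r := (q - p ^+ 2)^-1; pose al := r * (q * a - p * b); pose be := r * (b - p * a).
pose x : 'cV[K]_2 := \col_i (al * lu i + be * (e * mu i)).
have Gx : G *m x = \col_j (k * (a * l j + b * m j)).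
  apply/matrixP => i o; rewrite !mxE sum_I2 !mxE !GE.
  move: D; rewrite /dual_frame !sum_I2 => -[ee ll lm ml mm].
  have Ea : al + p * be = a by rewrite /al /be /r; field.
  have Eb : p * al + q * be = b by rewrite /al /be /r; field.
  set x0 := al * lu 0 + _; set x1 := al * lu 1 + _.
  have X : l 0 * x0 + l 1 * x1 = al.
    have -> : l 0 * x0 + l 1 * x1 = al * (lu 0 * l 0 + lu 1 * l 1) +
      be * e * (mu 0 * l 0 + mu 1 * l 1) by rewrite /x0 /x1; ring.
    by rewrite ll ml; ring.
  have Y : m 0 * x0 + m 1 * x1 = be.
    have -> : m 0 * x0 + m 1 * x1 = al * (lu 0 * m 0 + lu 1 * m 1) +
      be * e * (mu 0 * m 0 + mu 1 * m 1) by rewrite /x0 /x1; ring.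
    by rewrite lm mm -mulrA ee; ring.
  rewrite -[in RHS]Ea -[in RHS]Eb -X -Y; move: x0 x1 {X Y} => x0 x1; ring.
move=> i; transitivity (x i 0); last by rewrite mxE /al /be /r; ring.
rewrite -[x](mulKmx Gu) Gx mxE.
by apply: eq_bigr => j _; rewrite mxE.
Qed.
(** A symmetric [H] that kills [y] is a multiple [h n n] with [n = (- y 1, y 0)], and
    [l l + f h n n] has determinant [f h (l y)^2 = f^3 h]. The division-free form covers a vanishing
    component of [y]. *)
Lemma degenerate_hessian (y l : 'I_2 -> K) (H : 'I_2 -> 'I_2 -> K) (f : K) :
  \sum_i y i * l i = f -> (forall j, \sum_i y i * H i j = 0) ->
  H 0 1 = H 1 0 ->
  forall i j, ((l 0 * l 0 + f * H 0 0) * (l 1 * l 1 + f * H 1 1) -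
      (l 0 * l 1 + f * H 0 1) * (l 1 * l 0 + f * H 1 0)) *
    ((if i == 0 then - y 1 else y 0) * (if j == 0 then - y 1 else y 0)) =
    f ^+ 3 * H i j.
Proof.
move=> L Hy S i j; have := Hy 0; have := Hy 1; move: L.
rewrite !sum_I2 -S => L H1 H0.
have -> : H i j = if i == 0 then if j == 0 then H 0 0 else H 0 1
    else if j == 0 then H 0 1 else H 1 1.
  by case: (ord2P i) => ->; case: (ord2P j) => ->; rewrite //= S.
move: (y 0) (y 1) (l 0) (l 1) (H 0 0) (H 0 1) (H 1 1) L H0 H1 => {y l H Hy S}.
move=> y0 y1 l0 l1 a b c L H0 H1.
have Ea : a * y0 = - (b * y1) by apply/eqP; rewrite -addr_eq0 -H0; apply/eqP; ring.
have Ec : c * y1 = - (b * y0).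
  by apply/eqP; rewrite -addr_eq0 -H1; apply/eqP; ring.
set D := _ - _.
have D1 : D = f * (l0 ^+ 2 * c + l1 ^+ 2 * a - 2 * l0 * l1 * b) +
    f ^+ 2 * (a * c - b ^+ 2) by rewrite /D; ring.
(* The relations [Ea] and [Ec] reduce the bracket in [l] to [a (l y)^2] and make the [f ^+ 2] part
   cancel. The other two entries are similar. *)
have D00 : D * y1 ^+ 2 = f ^+ 3 * a.
  have -> : D * y1 ^+ 2 = f * (l0 ^+ 2 * (c * y1) * y1 + l1 ^+ 2 * a * y1 ^+ 2
    - 2 * l0 * l1 * (b * y1) * y1) + f ^+ 2 * (a * (c * y1) * y1 - (b * y1) ^+ 2).
    by rewrite D1; ring.
  rewrite Ec; have Eb : b * y1 = - (a * y0) by rewrite Ea opprK.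
  have -> : l0 ^+ 2 * - (b * y0) * y1 = - l0 ^+ 2 * y0 * (b * y1) by ring.
  have -> : a * - (b * y0) * y1 = - a * y0 * (b * y1) by ring.
  by rewrite Eb -L; ring.
have D11 : D * y0 ^+ 2 = f ^+ 3 * c.
  have -> : D * y0 ^+ 2 = f * (l0 ^+ 2 * c * y0 ^+ 2 + l1 ^+ 2 * (a * y0) * y0
    - 2 * l0 * l1 * y0 * (b * y0)) + f ^+ 2 * ((a * y0) * c * y0 - (b * y0) ^+ 2).
    by rewrite D1; ring.
  rewrite Ea; have Eb : b * y0 = - (c * y1) by rewrite Ec opprK.
  have -> : l1 ^+ 2 * - (b * y1) * y0 = - l1 ^+ 2 * y1 * (b * y0) by ring.
  have -> : - (b * y1) * c * y0 = - c * y1 * (b * y0) by ring.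
  by rewrite Eb -L; ring.
have D01 : D * (- y1 * y0) = f ^+ 3 * b.
  have -> : D * (- y1 * y0) = - f * (l0 ^+ 2 * (c * y1) * y0 +
    l1 ^+ 2 * (a * y0) * y1 - 2 * l0 * l1 * b * y0 * y1) -
    f ^+ 2 * ((a * y0) * (c * y1) - b ^+ 2 * y0 * y1) by rewrite D1; ring.
  by rewrite Ea Ec -L; ring.
case: (ord2P i) => ->; case: (ord2P j) => -> /=.
- by rewrite -D00; ring.
- by rewrite -D01; ring.
- by rewrite -D01; ring.
- by rewrite -D11; ring.
Qed.

(** Expanding one index leaves only its [m] component, since [lu] annihilates [C]. Contraction with
    [mu] preserves symmetry and annihilation by [lu], so the other indices follow in turn. *)
Lemma frame_cubic e l m lu mu f (C : 'I_2 -> 'I_2 -> 'I_2 -> K) :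
  dual_frame e l m lu mu ->
  (forall i j k, C i j k = C j i k) -> (forall i j k, C i j k = C i k j) ->
  (forall i j, \sum_k C i j k * lu k = 0) ->
  exists I, forall i j k, f * C i j k = I * m i * m j * m k.
Proof.
move=> D C12 C23 T.
have E3 i j k : C i j k = e * (\sum_k C i j k * mu k) * m k.
  by rewrite {1}(dual_frame_expand (C i j) D k) T mul0r add0r.
pose B i j := \sum_k C i j k * mu k.
have BT i : \sum_j B i j * lu j = 0.
  rewrite /B; under eq_bigr do rewrite mulr_suml.
  rewrite exchange_big big1// => k _.
  by under eq_bigr do rewrite mulrAC C23; rewrite -mulr_suml T mul0r.
have Bs i j : B i j = B j i by apply: eq_bigr => k _; rewrite C12.
have E2 i j : B i j = e * (\sum_j B i j * mu j) * m j.
  by rewrite {1}(dual_frame_expand (B i) D j) BT mul0r add0r.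
pose A i := \sum_j B i j * mu j.
have AT : \sum_i A i * lu i = 0.
  rewrite /A; under eq_bigr do rewrite mulr_suml.
  rewrite exchange_big big1// => j _.
  by under eq_bigr do rewrite mulrAC Bs; rewrite -mulr_suml BT mul0r.
have E1 i : A i = e * (\sum_i A i * mu i) * m i.
  by rewrite {1}(dual_frame_expand A D i) AT mul0r add0r.
exists (f * e ^+ 3 * \sum_i A i * mu i) => i j k.
by rewrite E3 -/(B i j) E2 -/(A i) E1; ring.
Qed.

(** In the application [phi] and [X] are the fibre gradient and Hessian of a function of degree 0,
    [p] and [p2] its first and second [;2] derivatives, [dp] the gradient of [p], [H] the Hessian of
    [F], and [M i k] is [d_k m_i]. Homogeneity gives the [lu] components of [X], so only the [mu mu]
    component [W] has to be computed. *)
Lemma frame_hessian e l m lu mu f p p2 I (phi dp : 'I_2 -> K)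
    (C : 'I_2 -> 'I_2 -> 'I_2 -> K) (H M X : 'I_2 -> 'I_2 -> K) :
  (2 : K) != 0 -> dual_frame e l m lu mu -> (forall i, f * phi i = p * m i) ->
  (forall i j k, f * C i j k = I * m i * m j * m k) ->
  (forall i j k, 2 * C i j k = H k i * l j + l i * H k j +
     e * (M i k * m j + m i * M j k)) ->
  (forall i j, X i j = X j i) ->
  (forall i k, f * X k i + phi i * l k = p * M i k + m i * dp k) ->
  (forall j, \sum_i (f * X i j) * lu i = - phi j) ->
  p2 = e * f * (\sum_i dp i * mu i) -> forall i j,
  f ^+ 2 * X i j = (p2 + e * I * p) * (m i * m j) - p * (l i * m j + m i * l j).
Proof.
move=> two_neq0 D Ep EC EH Xs EX XT -> i j.
pose Z j := \sum_i f * X i j * mu i; pose W := \sum_j Z j * mu j.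
have Y i' j' : f * X i' j' = - phi j' * l i' + e * Z j' * m i'.
  by rewrite (dual_frame_expand (fun i => f * X i j') D i') XT.
have [ee _ _ _ _] := D.
(* By symmetry of [X], contracting its other index with [lu] gives minus [phi] paired with [mu]. *)
have ZT : f * (\sum_j Z j * lu j) = - (p * e).
  have -> : \sum_j Z j * lu j = - (phi 0 * mu 0 + phi 1 * mu 1).
    have := XT 0; have := XT 1; rewrite /Z !sum_I2 (Xs 1 0) => X1 X0.
    rewrite -[phi 0]opprK -[phi 1]opprK -X1 -X0; ring.
  have [_ _ _ _] := D; rewrite sum_I2 => <-.
  by rewrite mulrN mulrDr !mulrA !Ep; ring.
have EZ : f * Z j = - (p * e) * l j + e * (f * W) * m j.
  rewrite (dual_frame_expand Z D j) mulrDr mulrA ZT -/W; ring.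
have EW : f * W = e * f * (\sum_i dp i * mu i) + e * I * p.
  pose S := mu 0 * mu 0 * M 0 0 + mu 0 * mu 1 * M 0 1 +
    (mu 1 * mu 0 * M 1 0 + mu 1 * mu 1 * M 1 1).
  have [_ _ _ ml mm] := D; rewrite !sum_I2 in ml mm.
  have ES : f * S = e * I.
    (* The cubic form [2 C] is evaluated on [mu] three times: by the main scalar in [T1], by the
       derivative of the metric in [T2], where the [l] terms vanish. *)
    pose T i j k := mu i * mu j * mu k * (f * (2 * C i j k)).
    have T1 : T 0 0 0 + T 0 0 1 + T 0 1 0 + T 0 1 1 + T 1 0 0 + T 1 0 1 +
        T 1 1 0 + T 1 1 1 = 2 * I * (mu 0 * m 0 + mu 1 * m 1) ^+ 3.
      have TE i' j' k' : T i' j' k' =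
          mu i' * mu j' * mu k' * (2 * (I * m i' * m j' * m k')).
        by rewrite -EC /T; ring.
      by rewrite !TE; ring.
    have T2 : T 0 0 0 + T 0 0 1 + T 0 1 0 + T 0 1 1 + T 1 0 0 + T 1 0 1 +
        T 1 1 0 + T 1 1 1 = f * (2 * (H 0 0 * mu 0 * mu 0 + H 0 1 * mu 0 * mu 1 +
          H 1 0 * mu 1 * mu 0 + H 1 1 * mu 1 * mu 1) * (mu 0 * l 0 + mu 1 * l 1) +
          2 * e * (mu 0 * m 0 + mu 1 * m 1) * S).
      by rewrite /T !EH /S; ring.
    have := etrans (esym T1) T2; rewrite ml mm mulr0 add0r => E.
    apply: (mulfI two_neq0); transitivity (f * (2 * e * e * S)).
      by transitivity (f * (2 * (e * e) * S)); [rewrite ee; ring | ring].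
    by rewrite -E; transitivity (2 * I * (e * e) * e); [ring | rewrite ee; ring].
  have WE : W = p * S + (mu 0 * m 0 + mu 1 * m 1) * (\sum_i dp i * mu i) -
      (phi 0 * mu 0 + phi 1 * mu 1) * (mu 0 * l 0 + mu 1 * l 1).
    have XE k i' : f * X k i' = p * M i' k + m i' * dp k - phi i' * l k.
      by rewrite -EX addrK.
    by rewrite /W /Z !sum_I2 !XE /S; ring.
  rewrite WE mm ml mulr0 subr0 mulrDr.
  have -> : f * (p * S) = p * (f * S) by ring.
  by rewrite ES; ring.
rewrite expr2 -mulrA Y mulrDr.
have -> : f * (- phi j * l i) = - (p * m j) * l i by rewrite -Ep; ring.
have -> : f * (e * Z j * m i) = e * (f * Z j) * m i by ring.
rewrite EZ EW; set s := e * f * _ + _.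
transitivity ((e * e) * (s * (m i * m j)) - p * (l i * m j + (e * e) * (m i * l j))).
  by ring.
by rewrite ee; ring.
Qed.

(** In the application [T k] is [F d_k phi + d_k F], [S k] its [;2] derivative, [D j k] its
    derivative along [y^j], and [c] is [e^(2 phi)]. The left side is then the Euler-Lagrange
    covector of the squared new metric. *)
Lemma frame_euler_lagrange e l m lu mu f p (c : K) (y phi T S : 'I_2 -> K)
    (D : 'I_2 -> 'I_2 -> K) : dual_frame e l m lu mu ->
  (forall k, y k = f * lu k) -> (forall j, f * phi j = p * m j) ->
  (forall k j, f * D j k = T k * l j + S k * m j) -> forall j,
  \sum_k y k * (2 * c * (2 * (f * phi j) * T k + l j * T k + f * D j k))
    - 2 * c * (f * T j) =
  c * (2 * f * (\sum_k T k * lu k) * l j +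
    2 * f * (2 * p * (\sum_k T k * lu k) + \sum_k S k * lu k
             - e * \sum_k T k * mu k) * m j).
Proof.
move=> DF Ey Ep ED j; rewrite [in X in _ - X](dual_frame_expand T DF j).
by rewrite !sum_I2 !Ey Ep !ED; ring.
Qed.

(** The left side is the new metric without its factor [e^(2 phi)]. The product rule gives the mixed
    term [l m + m l] the coefficient [2 p], and the Hessian takes away one [p]; with [s] from
    [frame_hessian], [s + 2 p^2] is [sigma]. *)
Lemma frame_conformal_metric e l m f p s (phi : 'I_2 -> K) (H X : 'I_2 -> 'I_2 -> K) :
  (forall i, f * phi i = p * m i) -> (forall i j, e * (m i * m j) = f * H i j) ->
  (forall i j, f ^+ 2 * X i j = s * (m i * m j) - p * (l i * m j + m i * l j)) ->
  forall i j, 2 * (f * phi i) * (f * phi j + l j) + l i * (f * phi j + l j) +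
    f * (f * X i j + phi j * l i + H i j) =
  l i * l j + p * (l i * m j + m i * l j) + (s + 2 * p ^+ 2 + e) * m i * m j.
Proof.
move=> Ep EH EX i j.
have -> : f * (f * X i j + phi j * l i + H i j) =
  f ^+ 2 * X i j + (f * phi j) * l i + f * H i j by ring.
by rewrite -EH EX !Ep; ring.
Qed.

End DualFrame.

(** * Smooth functions and Euler's identity *)

Section SmoothOn.
Context {R : realType} {V W : normedModType R}.
Implicit Types (U : set V) (u v w z : V).

Lemma smooth_on_derivable U (f : V -> W) v z :
  smooth_on U f -> U z -> derivable f z v.
Proof. by move=> sf Uz; exact: (sf [::] z Uz).2. Qed.

Lemma smooth_on_continuous U (f : V -> W) z :
  smooth_on U f -> U z -> {for z, continuous f}.
Proof. by move=> sf Uz; exact: (sf [::] z Uz).1. Qed.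

Lemma smooth_on_derive U (f : V -> W) v :
  smooth_on U f -> smooth_on U ('D_v f).
Proof.
(* The last direction of the list is the first one differentiated along. *)
move=> sf s z Uz; have := sf (s ++ [:: v]) z Uz.
by rewrite /iter_derive foldr_cat.
Qed.

Lemma smooth_on_cst U (c : W) : smooth_on U (cst c).
Proof.
move=> s z Uz; have [d ->] : exists d, iter_derive s (cst c : V -> W) = cst d.
  elim: s => [|v s [d IH]]; first by exists c.
  exists 0; rewrite /= -/(iter_derive s (cst c)) IH.
  by apply/funext => w; rewrite derive_cst.
by split; [exact: cst_continuous | move=> v; exact: derivable_cst].
Qed.

End SmoothOn.

Section RealValued.
Context {R : realType} {V : normedModType R}.
Implicit Types (U : set V) (f g : V -> R) (u v z : V).

Lemma smooth_on_derive_swap U f u v z : open U -> smooth_on U f -> U z ->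
  'D_u ('D_v f) z = 'D_v ('D_u f) z.
Proof.
move=> oU sf Uz; apply: (@derive_swap _ _ _ U).
- exact: open_nbhs_nbhs.
- by move=> w Uw; split; exact: smooth_on_derivable sf Uw.
- move=> w Uw; split.
    exact: smooth_on_derivable (smooth_on_derive _ sf) Uw.
  exact: smooth_on_derivable (smooth_on_derive _ sf) Uw.
- exact: smooth_on_continuous (smooth_on_derive _ (smooth_on_derive _ sf)) Uz.
- exact: smooth_on_continuous (smooth_on_derive _ (smooth_on_derive _ sf)) Uz.
Qed.

Lemma smooth_on_deriveDdir U f u v z : open U -> smooth_on U f -> U z ->
  'D_(u + v) f z = 'D_u f z + 'D_v f z.
Proof.
move=> oU sf Uz; apply: (@deriveDdir _ _ _ U).
- exact: open_nbhs_nbhs.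
- by move=> w Uw; split; exact: smooth_on_derivable sf Uw.
- exact: smooth_on_derivable sf Uz.
- exact: smooth_on_continuous (smooth_on_derive _ sf) Uz.
- exact: smooth_on_continuous (smooth_on_derive _ sf) Uz.
Qed.

Lemma smooth_on_is_derive U f v z :
  smooth_on U f -> U z -> is_derive z v f ('D_v f z).
Proof. by move=> sf Uz; apply: derivableP; exact: smooth_on_derivable sf Uz. Qed.

Lemma derive_eq_on U f g v z : open U -> U z -> (forall w, U w -> f w = g w) ->
  'D_v f z = 'D_v g z.
Proof.
move=> oU Uz fg; apply: near_eq_derive.
by apply: filterS fg _; exact: open_nbhs_nbhs.
Qed.

Lemma derivable_near f g (P : V -> Prop) v z : nbhs z P ->
  (forall w, P w -> f w = g w) -> derivable f z v -> derivable g z v.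
Proof. by move=> zP fg; apply: near_eq_derivable; exact: filterS fg zP. Qed.

Lemma derivable_eq_on U f g v z : open U -> U z -> (forall w, U w -> f w = g w) ->
  derivable f z v -> derivable g z v.
Proof.
by move=> oU Uz fg; apply: derivable_near fg; exact: open_nbhs_nbhs.
Qed.

Lemma is_derive_eq_on U f g v z (d : R) : open U -> U z ->
  (forall w, U w -> f w = g w) -> is_derive z v f d -> is_derive z v g d.
Proof.
move=> oU Uz fg; apply: near_eq_is_derive.
by apply: filterS fg _; exact: open_nbhs_nbhs.
Qed.

Lemma continuous_eq_on U f g z : open U -> U z ->
  (forall w, U w -> f w = g w) -> {for z, continuous f} -> {for z, continuous g}.
Proof.
move=> oU Uz fg; rewrite /prop_for /continuous_at (fg z Uz); apply: cvg_trans.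
by apply: near_eq_cvg; apply: filterS fg _; exact: open_nbhs_nbhs.
Qed.

Lemma derive_near_on U f g (P : V -> Prop) v z : open U -> U z -> nbhs z P ->
  (forall w, U w -> P w -> f w = g w) -> 'D_v f z = 'D_v g z.
Proof.
move=> oU Uz zP fg; apply: near_eq_derive.
have zU : nbhs z U by exact: open_nbhs_nbhs.
by apply: filterS (filterI zU zP) => w [Uw Pw]; exact: fg.
Qed.

(** Makes the signature locally constant, so that it can be frozen before differentiating. *)
Lemma sg_near f z : {for z, continuous f} -> f z != 0 ->
  \forall w \near z, Num.sg (f w) = Num.sg (f z).
Proof.
move=> C; rewrite neq_lt => /orP[d0|d0]; near=> w.
  by rewrite !ltr0_sg//; near: w; exact: (cvgr_lt _ C _ d0).
by rewrite !gtr0_sg//; near: w; exact: (cvgr_gt _ C _ d0).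
Unshelve. all: by end_near. Qed.

Lemma is_derive_add f g v z (a b : R) : is_derive z v f a ->
  is_derive z v g b -> is_derive z v (fun w => f w + g w) (a + b).
Proof. exact: is_deriveD. Qed.

Lemma is_derive_mul f g v z (a b : R) : is_derive z v f a ->
  is_derive z v g b -> is_derive z v (fun w => f w * g w) (f z * b + g z * a).
Proof. exact: is_deriveM. Qed.

Lemma is_derive_cmul f v z (c a : R) : is_derive z v f a ->
  is_derive z v (fun w => c * f w) (c * a).
Proof. exact: is_deriveZ. Qed.

Lemma is_derive_expR_comp f v z (a : R) : is_derive z v f a ->
  is_derive z v (fun w => expR (f w)) (expR (f z) * a).
Proof. by move=> Df; exact: is_derive_comp1 Df (is_derive_expR (f z)). Qed.

(** * Derivatives of the square of a conformally changed function *)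

Section Conformal.
Context (U : set V) (F phi G : V -> R) (oU : open U).
Context (sF : smooth_on U F) (sphi : smooth_on U phi).
Context (GE : forall w, U w -> G w = expR (phi w) * F w).

(** The last factor is grouped so that it becomes [dFphi] when [v] is a coordinate direction of the
    base. *)
Lemma derive_conformal_sqr v z : U z -> 'D_v (fun w => G w ^+ 2) z =
  2 * expR (phi z) ^+ 2 * (F z * (F z * 'D_v phi z + 'D_v F z)).
Proof.
move=> Uz.
have D1 := is_derive_mul (is_derive_expR_comp (smooth_on_is_derive v sphi Uz))
  (smooth_on_is_derive v sF Uz).
have [_ D2] := is_derive_mul D1 D1.
rewrite (@derive_eq_on U _ _ v z oU Uz
  (fun w Uw => etrans (congr1 (fun x => x ^+ 2) (GE Uw)) (expr2 _))).
rewrite D2; move: ('D_v phi z) ('D_v F z) (expR (phi z)) (F z) => a b c d; ring.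
Qed.

Lemma derive_derive_conformal_sqr u v z : U z ->
  'D_u ('D_v (fun w => G w ^+ 2)) z = 2 * expR (phi z) ^+ 2 *
   (2 * (F z * 'D_u phi z) * (F z * 'D_v phi z + 'D_v F z) +
    'D_u F z * (F z * 'D_v phi z + 'D_v F z) +
    F z * (F z * 'D_u ('D_v phi) z + 'D_v phi z * 'D_u F z + 'D_u ('D_v F) z)).
Proof.
move=> Uz.
have De := is_derive_expR_comp (smooth_on_is_derive u sphi Uz).
have DF := smooth_on_is_derive u sF Uz.
have DT := is_derive_add
  (is_derive_mul DF (smooth_on_is_derive u (smooth_on_derive v sphi) Uz))
  (smooth_on_is_derive u (smooth_on_derive v sF) Uz).
have [_ D2] := is_derive_mul (is_derive_cmul 2 (is_derive_mul De De))
  (is_derive_mul DF DT).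
rewrite (@derive_eq_on U _ _ u z oU Uz (fun w Uw => derive_conformal_sqr v Uw)).
rewrite D2; move: ('D_u phi z) ('D_v phi z) ('D_u F z) ('D_v F z)
  ('D_u ('D_v phi) z) ('D_u ('D_v F) z) (expR (phi z)) (F z).
by move=> a b c d f g h l; ring.
Qed.

End Conformal.

End RealValued.

Section Euler.
Context {R : realType}.
Notation E := ('rV[R]_2 * 'rV[R]_2)%type.
Implicit Types (U : set E) (f g : E -> R) (r : R) (i j k : 'I_2) (w z : E).

(** Homogeneity in infinitesimal form. The degree is a real number because second fibre derivatives
    of [F] have degree -1. *)
Definition euler_on U r f :=
  forall w, U w -> \sum_i w.2 0 i * dy i f w = r * f w.

(** The derivative at [s = 0] of [f (x, (1 + s) y)] is computed in two ways: as a directional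
    derivative, and from the factor [(1 + s) ^+ n]. *)
Lemma homogeneous_euler_on U (n : nat) f : open U -> smooth_on U f ->
  (forall w (c : R), U w -> 0 < c -> f (w.1, c *: w.2) = c ^+ n * f w) ->
  euler_on U n%:R f.
Proof.
move=> oU sf hf w Uw.
have -> : \sum_i w.2 0 i * dy i f w = 'D_(0, w.2) f w.
  have -> : ((0, w.2) : E) = w.2 0 0 *: ((0, delta_mx 0 0) : E) +
                             w.2 0 1 *: ((0, delta_mx 0 1) : E).
    rewrite [in LHS](row_sum_delta w.2) sum_I2.
    by congr (_, _); rewrite /= ?scaler0 ?addr0.
  rewrite (smooth_on_deriveDdir _ _ oU sf Uw) !deriveZdir ?sum_I2 //;
    exact: smooth_on_derivable sf Uw.
have D1 : is_derive (0 : R) 1 (fun s : R => f (w + s *: (0, w.2))) ('D_(0, w.2) f w).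
  have := @is_derive_line _ _ _ f w (0, w.2) 0; rewrite scale0r addr0; apply.
  exact: smooth_on_derivable sf Uw.
have D2 : is_derive (0 : R) 1 (fun s : R => (1 + s) ^+ n * f w) (n%:R * f w).
  have D3 : is_derive (0 : R) 1 (fun s : R => 1 + s) 1.
    by rewrite -[X in is_derive _ _ _ X]add0r; exact: is_derive_add.
  have D4 : is_derive (0 : R) 1 (fun s : R => (1 + s) ^+ n) n%:R.
    have := @is_deriveX _ _ _ n _ _ _ D3.
    rewrite addr0 expr1n mulr1 -[_ *: _]/(_ * _) mulr1.
    by congr is_derive; apply/funext => s; rewrite exprfctE.
  have := is_derive_mul D4 (is_derive_cst (f w) (0 : R) 1).
  by rewrite mulr0 add0r [in X in X -> _]mulrC.
(* The two functions of [s] are compared only for [s] near 0, where [1 + s] is positive. *)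
have D5 : is_derive (0 : R) 1 (fun s : R => f (w + s *: (0, w.2))) (n%:R * f w).
  apply: near_eq_is_derive D2; near=> s.
  rewrite -hf //; last first.
    by rewrite addrC -ltrBlDr sub0r; near: s; apply: lt_nbhsr; rewrite oppr_lt0.
  rewrite scalerDl scale1r; congr f.
  by case: w {Uw D1} => x y; congr (_, _); rewrite /= scaler0 addr0.
by rewrite -(@derive_val _ _ _ _ _ _ _ D1) (@derive_val _ _ _ _ _ _ _ D5).
Unshelve. all: by end_near. Qed.

End Euler.

Section EulerDerivatives.
Context {R : realType}.
Notation E := ('rV[R]_2 * 'rV[R]_2)%type.
Implicit Types (U : set E) (f g : E -> R) (r : R) (i j k : 'I_2) (v w z : E).

Lemma is_derive_fiber_coord i z v : is_derive z v (fun w : E => w.2 0 i) (v.2 0 i).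
Proof.
have C : (fun h : R => h^-1 *: (((fun w : E => w.2 0 i) \o shift z) (h *: v) - z.2 0 i))
    @ 0^' --> v.2 0 i.
  apply: cvg_near_cst; near=> h => /=.
  rewrite !mxE addrK -[_ *: _]/(_ * _) mulKf//.
  by near: h; exact: nbhs_dnbhs_neq.
split; last exact: cvg_lim C.
by apply/cvg_ex; exists (v.2 0 i).
Unshelve. all: by end_near. Qed.

(** Euler's identity differentiated along [v]; the correction term comes from the factors [y^i]. It
    vanishes for base directions and lowers the degree by one for fibre directions. *)
Lemma euler_on_derive U r f v w : open U -> smooth_on U f -> euler_on U r f ->
  U w ->
  \sum_i w.2 0 i * dy i ('D_v f) w = r * 'D_v f w - \sum_i v.2 0 i * dy i f w.
Proof.
move=> oU sf ef Uw.
have D i : is_derive w v (fun z => z.2 0 i * dy i f z)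
    (w.2 0 i * dy i ('D_v f) w + v.2 0 i * dy i f w).
  rewrite [v.2 0 i * _]mulrC /dy (smooth_on_derive_swap _ _ oU sf Uw).
  apply: is_derive_mul; first exact: is_derive_fiber_coord.
  exact: smooth_on_is_derive (smooth_on_derive _ sf) Uw.
have D1 := is_derive_add (D 0) (D 1).
have D2 : is_derive w v (fun z => r * f z) (r * 'D_v f w).
  by apply: is_derive_cmul; exact: smooth_on_is_derive sf Uw.
have := is_derive_eq_on oU Uw _ D1; move/(_ (fun z => r * f z)).
case=> [z Uz|_ D3]; first by rewrite -ef// sum_I2.
move: D2 => [_]; rewrite D3 !sum_I2 => <-.
by rewrite addrACA addrK.
Qed.

Lemma euler_on_dx U r f k : open U -> smooth_on U f -> euler_on U r f ->
  euler_on U r (dx k f).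
Proof.
move=> oU sf ef w Uw.
rewrite [LHS](euler_on_derive _ oU sf ef Uw) big1 ?subr0// => i _.
by rewrite mxE mul0r.
Qed.

Lemma euler_on_dy U r f k : open U -> smooth_on U f -> euler_on U r f ->
  euler_on U (r - 1) (dy k f).
Proof.
move=> oU sf ef w Uw.
rewrite [LHS](euler_on_derive _ oU sf ef Uw) mulrBl mul1r; congr (_ - _).
by rewrite (bigD1 k)//= big1 => [|i /negPf ik]; rewrite mxE ?eqxx ?ik ?mul1r ?addr0 ?mul0r.
Qed.

Lemma dy_swap U f i j w : open U -> smooth_on U f -> U w ->
  dy i (dy j f) w = dy j (dy i f) w.
Proof. by move=> oU sf Uw; exact: smooth_on_derive_swap oU sf Uw. Qed.

Lemma smooth_on_dx U f k : smooth_on U f -> smooth_on U (dx k f).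
Proof. exact: smooth_on_derive. Qed.

Lemma smooth_on_dy U f k : smooth_on U f -> smooth_on U (dy k f).
Proof. exact: smooth_on_derive. Qed.

Lemma dyE f k w : dy k f w = 'D_(0, delta_mx 0 k) f w.
Proof. by []. Qed.

Lemma is_derive_dy U f k w : smooth_on U f -> U w ->
  is_derive w (0, delta_mx 0 k) f (dy k f w).
Proof. exact: smooth_on_is_derive. Qed.

Lemma dy_eq_on U f g k w : open U -> U w -> (forall z, U z -> f z = g z) ->
  dy k f w = dy k g w.
Proof. exact: derive_eq_on. Qed.

End EulerDerivatives.

(** * The modified Berwald frame *)

Section Frame.
Context {R : realType}.
Notation E := ('rV[R]_2 * 'rV[R]_2)%type.
Implicit Types (f : E -> R) (r : R) (i j k : 'I_2) (v w z : E).
Context (U : set E) (F : E -> R) (oU : open U) (sF : smooth_on U F).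
Context (eF : euler_on U 1 F) (F0 : forall w, U w -> F w != 0).
Context (gU : forall w, U w -> gmx F w \in unitmx).

Lemma gmxE w i j : U w ->
  gmx F w i j = dy i F w * dy j F w + F w * dy i (dy j F) w.
Proof.
move=> Uw; rewrite mxE.
have D v z : U z -> is_derive z v (fun w => F w ^+ 2) (2 * (F z * 'D_v F z)).
  move=> Uz; rewrite mulr_natl mulr2n.
  by apply: is_derive_mul; exact: smooth_on_is_derive sF Uz.
rewrite (_ : dy i _ _ = 2 * (F w * dy i (dy j F) w + dy j F w * dy i F w)).
  by move: (F w) (dy i (dy j F) w) (dy j F w) (dy i F w) => a b c d; field.
have D1 : is_derive w (0, delta_mx 0 i) (fun z => 2 * (F z * dy j F z))
    (2 * (F w * dy i (dy j F) w + dy j F w * dy i F w)).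
  apply/is_derive_cmul/is_derive_mul; first exact: smooth_on_is_derive sF Uw.
  exact: smooth_on_is_derive (smooth_on_derive _ sF) Uw.
have [_ <-] := D1.
by apply: derive_eq_on oU Uw _ => z Uz; have [] := D (0, delta_mx 0 j) z Uz.
Qed.

Lemma hessian_tangent w j : U w -> \sum_i w.2 0 i * dy i (dy j F) w = 0.
Proof.
by move=> Uw; have := euler_on_dy j oU sF eF Uw; rewrite subrr mul0r.
Qed.

Lemma gmx_det_neq0 w : U w -> \det (gmx F w) != 0.
Proof. by move=> /gU; rewrite unitmxE unitfE. Qed.

Lemma signature_sqr w : U w -> signature F w * signature F w = 1.
Proof. by move=> /gmx_det_neq0 d0; rewrite -expr2 /signature sqr_sg d0. Qed.

Lemma signature_det w : signature F w * \det (gmx F w) = `|\det (gmx F w)|.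
Proof. by rewrite normrEsg. Qed.

Lemma det_gmxE w : U w -> \det (gmx F w) =
    (dy 0 F w * dy 0 F w + F w * dy 0 (dy 0 F) w) *
    (dy 1 F w * dy 1 F w + F w * dy 1 (dy 1 F) w) -
    (dy 0 F w * dy 1 F w + F w * dy 0 (dy 1 F) w) *
    (dy 1 F w * dy 0 F w + F w * dy 1 (dy 0 F) w).
Proof.
move=> Uw.
by rewrite det_mx2 (gmxE 0 0 Uw) (gmxE 0 1 Uw) (gmxE 1 0 Uw) (gmxE 1 1 Uw).
Qed.

(** Each [m_lo F i] is [n i / F] times the root of the absolute determinant, with [n] the rotated
    [y]. Clearing denominators leaves [degenerate_hessian] for the Hessian of [F]. *)
Lemma m_loM w i j : U w ->
  signature F w * (m_lo F i w * m_lo F j w) = F w * dy i (dy j F) w.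
Proof.
move=> Uw; have Fw := F0 Uw.
set n := fun i : 'I_2 => if i == 0 then - w.2 0 1 else w.2 0 0.
have mE k : m_lo F k w = Num.sqrt `|\det (gmx F w)| * (n k / F w).
  rewrite /m_lo signature_det /n /ell_up.
  by case: ifP => _ //; rewrite !(mulNr, mulrN).
have -> : signature F w * (m_lo F i w * m_lo F j w) =
    \det (gmx F w) * n i * n j / F w ^+ 2.
  rewrite !mE.
  have -> : forall s e, e * (s * (n i / F w) * (s * (n j / F w))) =
      e * (s ^+ 2) * n i * n j / F w ^+ 2 by move=> s e; field.
  rewrite sqr_sqrtr ?normr_ge0// -signature_det mulrA signature_sqr// mul1r.
  by [].
have dE := det_gmxE Uw.
have L := eF Uw; rewrite mul1r in L.
have := degenerate_hessian L (fun j => hessian_tangent j Uw)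
  (dy_swap 0 1 oU sF Uw) i j.
rewrite -dE /n; set ni := (X in _ * (X * _)); set nj := (X in _ * (_ * X)).
move: (\det _) (dy i (dy j F) w) => d h E.
by apply: (mulIf (expf_neq0 2 Fw)); rewrite divfK ?expf_neq0// -mulrA E; ring.
Qed.

Lemma gmx_frame w i j : U w -> gmx F w i j =
  dy i F w * dy j F w + signature F w * (m_lo F i w * m_lo F j w).
Proof. by move=> Uw; rewrite (m_loM _ _ Uw) (gmxE _ _ Uw). Qed.

Lemma gmx_m_up w i : U w -> \sum_j gmx F w i j * m_up F j w = m_lo F i w.
Proof.
move=> Uw; transitivity ((gmx F w *m (ginv F w *m \col_k m_lo F k w)) i 0).
  by rewrite mxE; apply: eq_bigr => j _; congr (_ * _); rewrite mxE;
    apply: eq_bigr => k _; congr (_ * _); rewrite mxE.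
by rewrite mulmxA mulmxV ?gU// mul1mx mxE.
Qed.

Lemma sqrt_det_gt0 w : U w -> 0 < Num.sqrt (signature F w * \det (gmx F w)).
Proof.
by move=> Uw; rewrite sqrtr_gt0 signature_det normr_gt0 gmx_det_neq0.
Qed.

(** By Euler's identity [y = 0] would force [F = 0]. *)
Lemma m_lo_neq0 w : U w -> exists i, m_lo F i w != 0.
Proof.
move=> Uw; have s0 := lt0r_neq0 (sqrt_det_gt0 Uw).
have := F0 Uw; rewrite -[F w]mul1r -(eF Uw) sum_I2 => y0.
have [x0|x0] := eqVneq (w.2 0 0) 0; last first.
  by exists 1; rewrite /m_lo /= mulf_neq0// mulf_neq0// ?invr_eq0 F0.
exists 0; rewrite /m_lo /= mulf_neq0 ?oppr_eq0// mulf_neq0 ?invr_eq0 ?F0//.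
apply/negP => /eqP x1; move: y0; rewrite x0 x1.
by move: (dy 0 F w) (dy 1 F w) => a b; rewrite !mul0r addr0 eqxx.
Qed.

Lemma ell_m_dual w : U w ->
  dual_frame (signature F w) (fun i => dy i F w) (fun i => m_lo F i w)
    (fun i => ell_up F i w) (fun i => m_up F i w).
Proof.
move=> Uw; have Fw := F0 Uw.
have ll : \sum_i ell_up F i w * dy i F w = 1.
  apply: (mulIf Fw); rewrite mulr_suml -(eF Uw).
  by apply: eq_bigr => i _; rewrite /ell_up mulrAC divfK.
have lm : \sum_i ell_up F i w * m_lo F i w = 0.
  rewrite sum_I2 /m_lo /=.
  by move: (ell_up F 0 w) (ell_up F 1 w) (Num.sqrt _) => a b s; ring.
(* Lowering the index of [ell_up] gives [dy j F], so this pairing equals that of [ell_up] with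
   [m_lo]. *)
have ml : \sum_i m_up F i w * dy i F w = 0.
  rewrite -[RHS]lm.
  under [RHS]eq_bigr => i _ do rewrite -(gmx_m_up i Uw) mulr_sumr.
  rewrite exchange_big; apply: eq_bigr => j _.
  transitivity (m_up F j w * \sum_i ell_up F i w * gmx F w i j); last first.
    by rewrite mulr_sumr; apply: eq_bigr => i _; 
      move: (m_up F j w) (ell_up F i w) (gmx F w i j) => a b c; ring.
  congr (_ * _); transitivity (\sum_i (ell_up F i w * dy i F w * dy j F w +
      ell_up F i w * m_lo F i w * (signature F w * m_lo F j w))).
    by rewrite big_split /= -!mulr_suml ll lm mul1r mul0r addr0.
  apply: eq_bigr => i _; rewrite (gmx_frame i j Uw).
  by move: (ell_up F i w) (dy i F w) (dy j F w) (m_lo F i w) (m_lo F j w)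
    (signature F w) => a b c d f g; ring.
split=> //; first exact: signature_sqr.
(* The frame form of the metric, applied to [m_up], returns [m_lo]; a nonzero component of [m_lo]
   can be cancelled. *)
have [i mi0] := m_lo_neq0 Uw.
have e2 := signature_sqr Uw.
apply: (mulfI mi0); rewrite [RHS]mulrC -[in RHS](gmx_m_up i Uw).
have -> : \sum_j gmx F w i j * m_up F j w =
  \sum_j (m_up F j w * dy j F w * dy i F w +
    (signature F w * m_lo F i w) * (m_up F j w * m_lo F j w)).
  apply: eq_bigr => j _; rewrite (gmx_frame i j Uw).
  by move: (m_up F j w) (dy i F w) (dy j F w) (m_lo F i w) (m_lo F j w)
    (signature F w) => a b c d f g; ring.
rewrite big_split /= -mulr_suml -mulr_sumr ml mul0r add0r.
by rewrite mulrA mulrA e2 mul1r.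
Qed.

(** In the dual-frame expansion of the fibre gradient, Euler's identity supplies the first
    coefficient, and [sc2] is the second one by definition. *)
Lemma dy_frame r f w j : euler_on U r f -> U w ->
  F w * dy j f w = r * f w * dy j F w + sc2 F f w * m_lo F j w.
Proof.
move=> ef Uw.
have E1 : F w * \sum_i dy i f w * ell_up F i w = r * f w.
  rewrite mulr_sumr -(ef _ Uw); apply: eq_bigr => i _.
  by rewrite mulrCA /ell_up [X in _ * X]mulrC divfK ?F0// mulrC.
rewrite (dual_frame_expand (fun j => dy j f w) (ell_m_dual Uw) j).
rewrite mulrDr mulrA E1 /sc2; congr (_ + _).
move: (\sum_i _) (F w) (signature F w) (m_lo F j w) => a b c d; ring.
Qed.

Lemma continuous_det_gmx z : U z -> {for z, continuous (fun w => \det (gmx F w))}.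
Proof.
move=> Uz.
have C0 : {for z, continuous F} := smooth_on_continuous sF Uz.
have C1 i : {for z, continuous (dy i F)}.
  exact: smooth_on_continuous (smooth_on_dy _ sF) Uz.
have C2 i j : {for z, continuous (dy i (dy j F))}.
  exact: smooth_on_continuous (smooth_on_dy _ (smooth_on_dy _ sF)) Uz.
have Cg i j : {for z, continuous (fun w => dy i F w * dy j F w + F w * dy i (dy j F) w)}.
  apply: (@continuousD _ _ _ (dy i F \* dy j F) (F \* dy i (dy j F)));
    by apply: continuousM.
apply: (continuous_eq_on oU Uz) (fun w Uw => esym (det_gmxE Uw)) _.
apply: continuousB; apply: continuousM; exact: Cg.
Qed.

Lemma derivable_det_gmx v z : U z -> derivable (fun w => \det (gmx F w)) z v.
Proof.
move=> Uz.
have D1 i : derivable (dy i F) z v.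
  exact: smooth_on_derivable (smooth_on_dy _ sF) Uz.
have D2 i j : derivable (dy i (dy j F)) z v.
  exact: smooth_on_derivable (smooth_on_dy _ (smooth_on_dy _ sF)) Uz.
have Dg i j : derivable (fun w => dy i F w * dy j F w + F w * dy i (dy j F) w) z v.
  apply: derivableD; apply: derivableM => //; exact: smooth_on_derivable sF Uz.
apply: derivable_eq_on oU Uz (fun w Uw => esym (det_gmxE Uw)) _.
by apply: derivableB; apply: derivableM; exact: Dg.
Qed.

(** With the signature frozen at its value at [z], the square root is taken of a positive
    differentiable function. *)
Lemma derivable_m_lo i v z : U z -> derivable (m_lo F i) z v.
Proof.
move=> Uz.
have D1 := is_derive_cmul (signature F z) (derivableP (derivable_det_gmx (v := v) Uz)).
have D2 := is_derive1_sqrt (_ : 0 < signature F z * \det (gmx F z)).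
have := D2; rewrite -sqrtr_gt0 => /(_ (sqrt_det_gt0 Uz)) {}D2.
have [D3 _] := is_derive_comp1 D1 D2.
have Dy k : derivable (fun w : E => w.2 0 k) z v by have [] := is_derive_fiber_coord k z v.
have Dl k : derivable (ell_up F k) z v.
  apply: derivableM; first exact: Dy.
  by apply: derivableV; [exact: F0 | exact: smooth_on_derivable sF Uz].
pose m e w := let s := Num.sqrt (e * \det (gmx F w)) in
  if i == 0 then - s * ell_up F 1 w else s * ell_up F 0 w.
have nE w : Num.sg (\det (gmx F w)) = Num.sg (\det (gmx F z)) ->
    m (signature F z) w = m_lo F i w.
  by move=> ew; exact: (congr1 (m^~ w) (esym ew)).
apply: derivable_near (sg_near (continuous_det_gmx Uz) (gmx_det_neq0 Uz)) nE _.
rewrite /m /=; case: (i == 0).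
  by apply: derivableM; [exact: derivableN | exact: Dl].
by apply: derivableM; [exact: D3 | exact: Dl].
Qed.

Lemma sum_m_lo_sqr_neq0 w : U w -> \sum_i m_lo F i w * m_lo F i w != 0.
Proof.
move=> Uw; rewrite psumr_neq0 => [|i _]; last by rewrite -expr2 sqr_ge0.
have [i mi] := m_lo_neq0 Uw; apply/hasP; exists i; first exact: mem_index_enum.
by rewrite /= lt0r -expr2 sqr_ge0 expf_neq0.
Qed.

(** Contracting [F d_i f = f_2 m_i] with [m_i] in the Euclidean sense gives a quotient formula for
    [sc2 F f], which avoids differentiating the inverse metric inside [m_up]. *)
Lemma derivable_sc2 f v z : smooth_on U f -> euler_on U 0 f -> U z ->
  derivable (sc2 F f) z v.
Proof.
move=> sf ef Uz.
have E w : U w -> (F w * (dy 0 f w * m_lo F 0 w + dy 1 f w * m_lo F 1 w)) *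
    (m_lo F 0 w * m_lo F 0 w + m_lo F 1 w * m_lo F 1 w)^-1 = sc2 F f w.
  move=> Uw; have := sum_m_lo_sqr_neq0 Uw; rewrite sum_I2 => m0.
  apply: (mulIf m0); rewrite divfK//.
  have := dy_frame 0 ef Uw; have := dy_frame 1 ef Uw.
  move: (F w) (f w) (dy 0 F w) (dy 1 F w) (dy 0 f w) (dy 1 f w) (m_lo F 0 w) (m_lo F 1 w) (sc2 F f w).
  move=> a f' l l' b c m n s; rewrite !mul0r !add0r => E1 E0.
  by rewrite mulrDr mulrA mulrA E0 E1; ring.
have Df i : derivable (dy i f) z v.
  exact: smooth_on_derivable (smooth_on_dy _ sf) Uz.
have Dm i : derivable (m_lo F i) z v := derivable_m_lo Uz.
apply: (derivable_eq_on oU Uz E).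
apply: derivableM.
  apply: derivableM; first exact: smooth_on_derivable sF Uz.
  by apply: derivableD; apply: derivableM; [exact: Df|exact: Dm|exact: Df|exact: Dm].
apply: derivableV; first by have := sum_m_lo_sqr_neq0 Uz; rewrite sum_I2.
by apply: derivableD; apply: derivableM; exact: Dm.
Qed.

Let two_neq0 : (2 : R) != 0.
Proof. by rewrite pnatr_eq0. Qed.

Lemma cartanE w i j k : U w -> 2 * cartan F i j k w =
  dy k (dy i F) w * dy j F w + dy i F w * dy k (dy j F) w +
  (dy k F w * dy i (dy j F) w + F w * dy k (dy i (dy j F)) w).
Proof.
move=> Uw; have D1 i' : is_derive w (0, delta_mx 0 k) (dy i' F) (dy k (dy i' F) w).
  exact: is_derive_dy (smooth_on_dy _ sF) Uw.
have D2 : is_derive w (0, delta_mx 0 k) (dy i (dy j F)) (dy k (dy i (dy j F)) w).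
  exact: is_derive_dy (smooth_on_dy _ (smooth_on_dy _ sF)) Uw.
have D3 : is_derive w (0, delta_mx 0 k) F (dy k F w) := is_derive_dy _ sF Uw.
have [_ E] := is_derive_eq_on oU Uw (fun z Uz => esym (gmxE i j Uz))
  (is_derive_add (is_derive_mul (D1 i) (D1 j)) (is_derive_mul D3 D2)).
have -> : 2 * cartan F i j k w = dy k (fun w0 => gmx F w0 i j) w.
  by rewrite /cartan mulVKf.
rewrite dyE E; move: (@dy R) => d.
by move: (d k (d i (d j F)) w) => a; ring.
Qed.

Lemma dy3_swap w i j k : U w -> dy k (dy i (dy j F)) w = dy k (dy j (dy i F)) w.
Proof. by move=> Uw; apply: (derive_eq_on _ oU Uw) => z Uz; exact: dy_swap oU sF Uz. Qed.

Lemma cartan_swap12 w i j k : U w -> cartan F i j k w = cartan F j i k w.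
Proof.
move=> Uw; apply: (mulfI two_neq0).
have := cartanE i j k Uw; have := cartanE j i k Uw.
have := dy3_swap i j k Uw; have := dy_swap i j oU sF Uw.
move: (@dy R) (@cartan R) => d c E1 E2 -> ->.
by rewrite E1 E2; ring.
Qed.

Lemma cartan_swap23 w i j k : U w -> cartan F i j k w = cartan F i k j w.
Proof.
move=> Uw; apply: (mulfI two_neq0).
have := cartanE i j k Uw; have := cartanE i k j Uw.
have := dy_swap k j oU (smooth_on_dy i sF) Uw.
have := dy3_swap i j k Uw; have := dy3_swap i k j Uw.
have := dy_swap i j oU sF Uw; have := dy_swap i k oU sF Uw.
have := dy_swap k j oU sF Uw.
move: (@dy R) (@cartan R) => d c E1 E2 E3 E4 E5 E6 -> ->.
by rewrite E1 E2 E3 E4 E5 E6; ring.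
Qed.

(** The metric has degree 0 in [y]. Concretely, the two gradient terms vanish with the tangential
    Hessian, and the degree -1 of the Hessian of [F] cancels the degree 1 of [F]. *)
Lemma cartan_tangent w i j : U w -> \sum_k cartan F i j k w * ell_up F k w = 0.
Proof.
move=> Uw; have Fw := F0 Uw.
have := euler_on_dy i oU (smooth_on_dy j sF) (euler_on_dy j oU sF eF) Uw.
have := eF Uw; have := hessian_tangent j Uw; have := hessian_tangent i Uw.
have := fun k => cartanE i j k Uw; rewrite /ell_up.
move: (@dy R) (@cartan R) => d c Ec H0 H1 H2 H3.
apply: (mulfI (mulf_neq0 two_neq0 Fw)); rewrite mulr0 mulr_sumr.
transitivity (d j F w * (\sum_k w.2 0 k * d k (d i F) w) +
  d i F w * (\sum_k w.2 0 k * d k (d j F) w) +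
  d i (d j F) w * (\sum_k w.2 0 k * d k F w) +
  F w * (\sum_k w.2 0 k * d k (d i (d j F)) w)); last first.
  by rewrite H0 H1 H2 H3; ring.
rewrite !mulr_sumr -!big_split /=; apply: eq_bigr => k _.
have -> : 2 * F w * (c F i j k w * (w.2 0 k / F w)) = (2 * c F i j k w) * w.2 0 k.
  by move: (w.2 0 k) => y; field.
by rewrite Ec; move: (w.2 0 k) => y; ring.
Qed.

(** [main_scalar] is a choice with default 0, so its equation holds once [frame_cubic] provides a
    witness. *)
Lemma main_scalarP w i j k : U w -> F w * cartan F i j k w =
  main_scalar F w * m_lo F i w * m_lo F j w * m_lo F k w.
Proof.
move=> Uw; suff : exists I, forall i j k, F w * cartan F i j k w =
    I * m_lo F i w * m_lo F j w * m_lo F k w.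
  by move/(@xgetPex R 0); exact.
exact: (frame_cubic (F w) (ell_m_dual Uw) (fun i j k => cartan_swap12 i j k Uw)
  (fun i j k => cartan_swap23 i j k Uw) (fun i j => cartan_tangent i j Uw)).
Qed.

(** The frame form of the metric is differentiated with the signature frozen at [w]. Compared with
    [main_scalarP], this determines the derivative of [m_lo] that [frame_hessian] needs. *)
Lemma cartan_m_lo w i j k : U w -> 2 * cartan F i j k w =
  dy k (dy i F) w * dy j F w + dy i F w * dy k (dy j F) w +
  signature F w * (dy k (m_lo F i) w * m_lo F j w + m_lo F i w * dy k (m_lo F j) w).
Proof.
move=> Uw; have D1 i' : is_derive w (0, delta_mx 0 k) (dy i' F) (dy k (dy i' F) w).
  exact: is_derive_dy (smooth_on_dy _ sF) Uw.
have D2 i' : is_derive w (0, delta_mx 0 k) (m_lo F i') (dy k (m_lo F i') w).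
  by apply: derivableP; exact: derivable_m_lo.
have N := sg_near (continuous_det_gmx Uw) (gmx_det_neq0 Uw).
have [_ D3] := is_derive_add (is_derive_mul (D1 i) (D1 j))
  (is_derive_cmul (signature F w) (is_derive_mul (D2 i) (D2 j))).
have -> : 2 * cartan F i j k w = dy k (fun w0 => gmx F w0 i j) w.
  by rewrite /cartan mulVKf.
transitivity ('D_(0, delta_mx 0 k) (fun w0 : E => dy i F w0 * dy j F w0 +
    signature F w * (m_lo F i w0 * m_lo F j w0)) w); last first.
  by rewrite D3; move: (@dy R) (@m_lo R) (@signature R) => d m e; ring.
apply: (derive_near_on _ oU Uw N) => z Uz ez; rewrite (gmx_frame i j Uz).
exact: (congr1 (fun e => dy i F z * dy j F z + e * (m_lo F i z * m_lo F j z)) ez).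
Qed.

Lemma hessian_frame f w i j : smooth_on U f -> euler_on U 0 f -> U w ->
  F w ^+ 2 * dy i (dy j f) w =
  (sc2 F (sc2 F f) w + signature F w * main_scalar F w * sc2 F f w) *
     (m_lo F i w * m_lo F j w) -
  sc2 F f w * (dy i F w * m_lo F j w + m_lo F i w * dy j F w).
Proof.
move=> sf ef Uw.
have D2 i' k : is_derive w (0, delta_mx 0 k) (m_lo F i') (dy k (m_lo F i') w).
  by apply: derivableP; exact: derivable_m_lo.
have D3 k : is_derive w (0, delta_mx 0 k) (sc2 F f) (dy k (sc2 F f) w).
  by apply: derivableP; exact: derivable_sc2.
have G z i' : U z -> F z * dy i' f z = sc2 F f z * m_lo F i' z.
  by move=> Uz; rewrite (dy_frame i' ef Uz) mul0r mul0r add0r.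
have GD i' k : F w * dy k (dy i' f) w + dy i' f w * dy k F w =
    sc2 F f w * dy k (m_lo F i') w + m_lo F i' w * dy k (sc2 F f) w.
  have [_ <-] := is_derive_mul (D3 k) (D2 i' k).
  have D4 : is_derive w (0, delta_mx 0 k) F (dy k F w) := is_derive_dy _ sF Uw.
  have D5 : is_derive w (0, delta_mx 0 k) (dy i' f) (dy k (dy i' f) w).
    exact: is_derive_dy (smooth_on_dy _ sf) Uw.
  have [_ <-] := is_derive_mul D4 D5.
  by apply: (dy_eq_on _ oU Uw) => z Uz; exact: G.
have T j' : \sum_i (F w * dy i (dy j' f) w) * ell_up F i w = - dy j' f w.
  have := euler_on_dy j' oU sf ef Uw; rewrite sub0r mulN1r => <-.
  have := F0 Uw; rewrite /ell_up; move: (@dy R) => d Fw.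
  by apply: eq_bigr => i' _; move: (w.2 0 i') => y; field.
exact: (frame_hessian two_neq0 (ell_m_dual Uw) (fun i => G w i Uw)
  (fun i j k => main_scalarP i j k Uw) (fun i j k => cartan_m_lo i j k Uw)
  (fun i j => dy_swap i j oU sf Uw) GD T (erefl _) i j).
Qed.

End Frame.

(** * The spray of a conformally changed metric *)

Section ConformalSpray.
Context {R : realType}.
Notation E := ('rV[R]_2 * 'rV[R]_2)%type.
Implicit Types (i j k : 'I_2) (w z : E).
Context (U : set E) (F phi G : E -> R) (oU : open U).
Context (sF : smooth_on U F) (sphi : smooth_on U phi).
Context (eF : euler_on U 1 F) (ephi : euler_on U 0 phi).
Context (F0 : forall w, U w -> F w != 0).
Context (gU : forall w, U w -> gmx F w \in unitmx).
Context (GE : forall w, U w -> G w = expR (phi w) * F w).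

Let dual z (Uz : U z) := ell_m_dual oU sF eF F0 gU Uz.

Let phi_frame z (Uz : U z) i : F z * dy i phi z = sc2 F phi z * m_lo F i z.
Proof. by rewrite (dy_frame oU sF eF F0 gU i ephi Uz) mul0r mul0r add0r. Qed.

Let dy_dy_sqr z i j : U z -> dy i (dy j (fun w => G w ^+ 2)) z =
  2 * expR (phi z) ^+ 2 *
   (2 * (F z * dy i phi z) * (F z * dy j phi z + dy j F z) +
    dy i F z * (F z * dy j phi z + dy j F z) +
    F z * (F z * dy i (dy j phi) z + dy j phi z * dy i F z + dy i (dy j F) z)).
Proof. exact: derive_derive_conformal_sqr. Qed.

Let dy_dx_sqr z j k : U z -> dy j (dx k (fun w => G w ^+ 2)) z =
  2 * expR (phi z) ^+ 2 *
   (2 * (F z * dy j phi z) * dFphi F phi k z + dy j F z * dFphi F phi k z +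
    F z * (F z * dy j (dx k phi) z + dx k phi z * dy j F z + dy j (dx k F) z)).
Proof. exact: derive_derive_conformal_sqr. Qed.

Let dx_sqr z j : U z -> dx j (fun w => G w ^+ 2) z =
  2 * expR (phi z) ^+ 2 * (F z * dFphi F phi j z).
Proof. exact: derive_conformal_sqr. Qed.

Lemma gmx_conformal z i j : U z -> gmx G z i j = expR (phi z) ^+ 2 *
  (dy i F z * dy j F z +
   sc2 F phi z * (dy i F z * m_lo F j z + m_lo F i z * dy j F z) +
   (sigma F phi z + signature F z) * m_lo F i z * m_lo F j z).
Proof.
move=> Uz; rewrite mxE (dy_dy_sqr i j Uz).
have := frame_conformal_metric (phi_frame Uz)
  (fun i j => m_loM oU sF eF F0 gU i j Uz)
  (fun i j => hessian_frame oU sF eF F0 gU i j sphi ephi Uz) i j.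
rewrite /sigma; move: (@dy R) (@m_lo R) (@sc2 R) (@signature R) => d m s e H.
rewrite -mulrA mulKf ?pnatr_eq0// H; ring.
Qed.

Lemma is_derive_dFphi i k z : U z -> is_derive z (0, delta_mx 0 i) (dFphi F phi k)
  (F z * dy i (dx k phi) z + dx k phi z * dy i F z + dy i (dx k F) z).
Proof.
move=> Uz; apply: is_derive_add.
  apply: is_derive_mul; first exact: is_derive_dy sF Uz.
  exact: is_derive_dy (smooth_on_dx _ sphi) Uz.
exact: is_derive_dy (smooth_on_dx _ sF) Uz.
Qed.

Let dy_dFphi z i k : U z -> dy i (dFphi F phi k) z =
  F z * dy i (dx k phi) z + dx k phi z * dy i F z + dy i (dx k F) z.
Proof. by move=> Uz; rewrite dyE; have [] := is_derive_dFphi i k Uz. Qed.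

(** Degree 1 is what lets [dy_frame] expand the fibre gradient of [dFphi]. *)
Lemma euler_on_dFphi k : euler_on U 1 (dFphi F phi k).
Proof.
move=> z Uz; have E1 := eF Uz; have E2 := euler_on_dx k oU sphi ephi Uz.
have E3 := euler_on_dx k oU sF eF Uz.
under eq_bigr do rewrite (dy_dFphi _ _ Uz).
rewrite /dFphi; move: E1 E2 E3; move: (@dy R) (@dx R) => d x.
rewrite !sum_I2.
move: (z.2 0 0) (z.2 0 1) => a b E1 E2 E3.
rewrite mul1r in E1; rewrite mul0r in E2; rewrite mul1r in E3.
transitivity (F z * (a * d 0 (x k phi) z + b * d 1 (x k phi) z) +
  x k phi z * (a * d 0 F z + b * d 1 F z) +
  (a * d 0 (x k F) z + b * d 1 (x k F) z)); first by ring.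
by rewrite E1 E2 E3; ring.
Qed.

Let ell_upM z k : U z -> F z * ell_up F k z = z.2 0 k.
Proof. by move=> Uz; rewrite /ell_up mulrC divfK// F0. Qed.

Let dy_frame_dFphi z k j : U z -> F z * dy j (dFphi F phi k) z =
  dFphi F phi k z * dy j F z + sc2 F (dFphi F phi k) z * m_lo F j z.
Proof.
move=> Uz.
by rewrite (dy_frame oU sF eF F0 gU j (@euler_on_dFphi k) Uz) mul1r.
Qed.

(** [frame_solve] is applied with [p = phi_2] and [q = sigma + e], so that [q - p ^+ 2] is
    [rho_den], to the covector given by [frame_euler_lagrange]. *)
Lemma spray_conformal_frame z i : U z -> rho_den F phi z != 0 ->
  spray G i z = 2^-1 * F z *
    ((\sum_k dFphi F phi k z * ell_up F k z) * ell_up F i z +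
     rho F phi z * (sc2 F phi z * (\sum_k dFphi F phi k z * ell_up F k z) +
       \sum_k sc2 F (dFphi F phi k) z * ell_up F k z -
       signature F z * \sum_k dFphi F phi k z * m_up F k z) *
     (signature F z * m_up F i z - sc2 F phi z * ell_up F i z)).
Proof.
move=> Uz r0; have ef0 : expR (phi z) ^+ 2 != 0 by rewrite expf_neq0// gt_eqF ?expR_gt0.
have S a b := frame_solve a b (dual Uz) ef0 r0 (fun i j => gmx_conformal i j Uz).
have EL := @frame_euler_lagrange _ _ _ _ _ _ _ _ (expR (phi z) ^+ 2)
  _ _ _ _ _ (dual Uz)
  (fun k => esym (ell_upM k Uz)) (phi_frame Uz)
  (fun k j => dy_frame_dFphi k j Uz).
have -> : spray G i z = 4^-1 * \sum_j invmx (gmx G z) i j * (expR (phi z) ^+ 2 *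
    (2 * F z * (\sum_k dFphi F phi k z * ell_up F k z) * dy j F z +
     2 * F z * (2 * sc2 F phi z * (\sum_k dFphi F phi k z * ell_up F k z) +
       \sum_k sc2 F (dFphi F phi k) z * ell_up F k z -
       signature F z * \sum_k dFphi F phi k z * m_up F k z) * m_lo F j z)).
  rewrite /spray; congr (_ * _); apply: eq_bigr => j _; congr (_ * _).
  rewrite -EL (dx_sqr j Uz); congr (_ - _); apply: eq_bigr => k _; congr (_ * _).
  by rewrite (dy_dx_sqr j k Uz) (dy_dFphi j k Uz).
rewrite S -/(rho_den F phi z) -/(rho F phi z).
have : rho F phi z * rho_den F phi z = 1 by rewrite mulVf.
rewrite /rho_den; set q := sigma F phi z + signature F z.
move: (\sum_k dFphi F phi k z * ell_up F k z)
  (\sum_k sc2 F (dFphi F phi k) z * ell_up F k z)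
  (\sum_k dFphi F phi k z * m_up F k z) => tl t2 tm.
move: (rho F phi z) (sc2 F phi z) (F z) (ell_up F i z) (m_up F i z)
  (signature F z) => r p f lu mu e; move: q => q Er.
(* The [ell_up] coefficient is split into a multiple of [rho_den], which cancels [rho], and a
   remainder with the same bracket as the [m_up] coefficient. *)
transitivity (2^-1 * f * (tl * lu * (r * (q - p ^+ 2)) +
  r * (p * tl + t2 - e * tm) * (e * mu - p * lu))); last by rewrite Er mulr1.
by field.
Qed.

End ConformalSpray.

(** * Comparison of the two sprays *)

Section SprayRelation.
Context {R : realType}.
Notation E := ('rV[R]_2 * 'rV[R]_2)%type.
Implicit Types (i j k : 'I_2) (w z : E).
Context (U : set E) (F phi G : E -> R) (oU : open U).
Context (sF : smooth_on U F) (sphi : smooth_on U phi).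
Context (eF : euler_on U 1 F) (ephi : euler_on U 0 phi).
Context (F0 : forall w, U w -> F w != 0).
Context (gU : forall w, U w -> gmx F w \in unitmx).
Context (GE : forall w, U w -> G w = expR (phi w) * F w).

Let zero : E -> R := cst 0.

Let dx_zero k z : dx k zero z = 0. Proof. exact: derive_cst. Qed.

Let dy_zero k z : dy k zero z = 0. Proof. exact: derive_cst. Qed.

Let sc2_zero : sc2 F zero = zero.
Proof.
apply/funext => z; rewrite /sc2 big1 ?mulr0// => i _.
by rewrite dy_zero mul0r.
Qed.

Let dFphi_zero k : dFphi F zero k = dx k F.
Proof.
by apply/funext => z; rewrite /dFphi dx_zero; move: (dx k F z) => d; rewrite mulr0 add0r.
Qed.

Let rho_den_zero z : rho_den F zero z = signature F z.
Proof.
rewrite /rho_den /sigma sc2_zero sc2_zero /zero /= expr0n /= !mulr0.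
by rewrite !add0r subr0.
Qed.

(* The case [phi = 0] of [spray_conformal_frame]. *)
Lemma spray_frame z i : U z -> spray F i z = 2^-1 * F z *
    ((\sum_k dx k F z * ell_up F k z) * ell_up F i z +
     (\sum_k sc2 F (dx k F) z * ell_up F k z -
       signature F z * \sum_k dx k F z * m_up F k z) * m_up F i z).
Proof.
move=> Uz; have e2 := signature_sqr gU Uz.
have e0 : signature F z != 0.
  by apply/eqP => e0; move: e2; rewrite e0 mul0r => /esym/eqP; rewrite oner_eq0.
have r0 : rho_den F zero z != 0 by rewrite rho_den_zero.
have ez : euler_on U 0 zero.
  by move=> w _; rewrite mul0r big1// => i' _; rewrite dy_zero mulr0.
have GE0 w : U w -> F w = expR (zero w) * F w by move=> _; rewrite expR0 mul1r.
rewrite (spray_conformal_frame oU sF (smooth_on_cst 0) eF ez F0 gU GE0 i Uz r0).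
rewrite /rho rho_den_zero sc2_zero /zero /= !mul0r.
under eq_bigr do rewrite dFphi_zero.
under [X in _ * (_ + _ * (_ + X - _) * _)]eq_bigr do rewrite dFphi_zero.
under [X in _ * (_ + _ * (_ - _ * X) * _)]eq_bigr do rewrite dFphi_zero.
(* For [phi = 0] the factor [rho] is the inverse signature, which is the signature itself and
   cancels the one in front of [m_up]. *)
have -> : (signature F z)^-1 = signature F z.
  by apply: (mulfI e0); rewrite mulfV// e2.
move: e2; move: (signature F z) (\sum_k dx k F z * ell_up F k z)
  (\sum_k sc2 F (dx k F) z * ell_up F k z) (\sum_k dx k F z * m_up F k z).
move=> e tl t2 tm e2; congr (_ * (_ + _)).
rewrite subr0 add0r; transitivity ((e * e) * (t2 - e * tm) * m_up F i z).
  by move: (m_up F i z) => m; ring.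
by rewrite e2 mul1r.
Qed.

(** [Acoef] is [2 F rho] times the bracket of [spray_conformal_frame]. In the difference of the
    sprays the [ell_up] contributions of [d_k F] cancel and those of [d_k phi] remain; the [m_up]
    part of [spray F] is what [Qcoef] subtracts. *)
Lemma spray_conformal z i : U z -> rho_den F phi z != 0 ->
  spray G i z =
    spray F i z + Qcoef F phi z * m_up F i z + Pcoef F phi z * ell_up F i z.
Proof.
move=> Uz r0.
rewrite (spray_conformal_frame oU sF sphi eF ephi F0 gU GE i Uz r0).
rewrite (spray_frame i Uz).
set tl := \sum_k dFphi F phi k z * ell_up F k z.
set t2 := \sum_k sc2 F (dFphi F phi k) z * ell_up F k z.
set tm := \sum_k dFphi F phi k z * m_up F k z.
have AE : Acoef F phi z = 2 * F z * rho F phi z *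
    (sc2 F phi z * tl + t2 - signature F z * tm).
  rewrite /Acoef -/tm; move: (sc2 F phi z) (rho F phi z) => p r.
  rewrite mulrBr mulrDr; congr (_ - _); last first.
    by move: (signature F z) tm => e t; ring.
  rewrite mulrA /tl /t2 !mulr_sumr -big_split; apply: eq_bigr => k _ /=.
  move: (dFphi F phi k z) (sc2 F (dFphi F phi k) z) (ell_up F k z) => t s l.
  by ring.
have tlE : tl = F z * (\sum_k dx k phi z * ell_up F k z) +
    \sum_k dx k F z * ell_up F k z.
  rewrite /tl mulr_sumr -big_split; apply: eq_bigr => k _.
  by rewrite /dFphi mulrDl mulrA.
rewrite /Qcoef /Pcoef {}AE {}tlE; clearbody t2 tm.
move: (\sum_k dx k phi z * ell_up F k z) (\sum_k dx k F z * ell_up F k z)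
  (\sum_k dx k F z * m_up F k z) (\sum_k sc2 F (dx k F) z * ell_up F k z).
move: (rho F phi z) (sc2 F phi z) (m_up F i z) (ell_up F i z) (signature F z).
by move=> r p m l e a b c d; field.
Qed.

End SprayRelation.

(** * Induced coordinates on the tangent bundle *)

Section TangentCoordinates.
Context {R : realType} {M : surface R}.
Implicit Types (A : set (tangent M)) (f : tangent M -> R) (a : chart M).

(** The transition rule determines the components in every chart around the point, and the others
    are 0 by convention. *)
Lemma tcoord_inj a (v w : tangent M) : dom a (base v) -> dom a (base w) ->
  tcoord a v = tcoord a w -> v = w.
Proof.
case: v w => [p c ct c0] [q d dt d0] /= pa qa [pq cd].
have E : p = q by rewrite -(coordK pa) -(coordK qa) pq.
subst q.
have F : c = d.
  apply/funext => b; have [pb|pb] := pselect (dom b p).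
    by rewrite (ct a b pa pb) (dt a b pa pb) cd.
  by rewrite (c0 b pb) (d0 b pb).
subst d.
by congr Tangent; exact: Prop_irrelevance.
Qed.

Lemma loc_fun_tcoord a f (v : tangent M) : dom a (base v) ->
  loc_fun a f (tcoord a v) = f v.
Proof.
move=> va; apply: xget_unique; first by exists v.
by move=> r [w [wa wv ->]]; rewrite (tcoord_inj wa va wv).
Qed.

Lemma loc_setP a A z : loc_set a A z ->
  exists v, [/\ A v, dom a (base v) & z = tcoord a v].
Proof. by move=> [v [Av va] <-]; exists v. Qed.

(** Scaling a tangent vector scales its fibre coordinates in every chart. *)
Lemma loc_fun_homogeneous a A f n z (c : R) :
  (forall v c, A v -> 0 < c -> A (tscale c v)) -> homogeneous A n f ->
  loc_set a A z -> 0 < c ->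
  loc_fun a f (z.1, c *: z.2) = c ^+ n * loc_fun a f z.
Proof.
move=> cA hf /loc_setP[v [Av va ->]] c0.
rewrite (loc_fun_tcoord f va) -hf//.
exact: (@loc_fun_tcoord a f (tscale c v) va).
Qed.

End TangentCoordinates.

Theorem proposition3p5 (R : realType) (M : surface R) (A : set (tangent M))
    (F phi : tangent M -> R) :
  conic_pseudo_Finsler A F ->
  (forall v, A v -> F v != 0) ->
  tsmooth A phi ->
  homogeneous A 0 phi ->
  (forall a z, loc_set a A z ->
     rho_den (loc_fun a F) (loc_fun a phi) z != 0) ->
  forall (a : chart M) z, loc_set a A z ->
  forall i : 'I_2,
    let Fa := loc_fun a F in
    let phia := loc_fun a phi in
    let Fbara := loc_fun a (fun v => expR (phi v) * F v) in
    spray Fbara i z =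
      spray Fa i z + Qcoef Fa phia z * m_up Fa i z
      + Pcoef Fa phia z * ell_up Fa i z.
Proof.
move=> [[_ oA _ _ cA] sF hF gF] F0 sphi hphi r0 a z Az i Fa phia Fbara.
(* The claim is local: on the open set [loc_set a A] every coordinate expression is the value at an
   actual tangent vector of [A]. *)
apply: (@spray_conformal _ (loc_set a A)) => //.
- exact: homogeneous_euler_on (oA a) (sF a) (fun w c Aw =>
    loc_fun_homogeneous cA hF Aw).
- exact: homogeneous_euler_on (oA a) (sphi a) (fun w c Aw =>
    loc_fun_homogeneous cA hphi Aw).
- by move=> w /loc_setP[v [Av va ->]]; rewrite /Fa loc_fun_tcoord// F0.
- exact: gF.
- by move=> w /loc_setP[v [Av va ->]]; rewrite /Fbara /Fa /phia !loc_fun_tcoord.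
- exact: r0.
Qed.
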